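(* Let $X$ be a Banach space with property $( * )$. Let $Y\subset X$ be a closed linear subspace and $f:Y\to\mathbb{R}$ a $\mathcal{C}^1$-smooth function. Then there is a $\mathcal{C}^1$-smooth function $H:X\to\mathbb{R}$ with $H|_Y=f$. Furthermore, there is a constant $C\ge 1$ depending only on $X$ such that whenever $f:Y\to\mathbb{R}$ is $\mathcal{C}^1$-smooth and Lipschitz on $Y$, there is a $\mathcal{C}^1$-smooth and Lipschitz function $H:X\to\mathbb{R}$ with $H|_Y=f$ and $\operatorname{Lip}(H)\le C\operatorname{Lip}(f)$.
   Context: A Banach space $X$ has property $( * )$ if there is a constant $C_0$, depending only on $X$, such that for every Lipschitz function $f:X\to\mathbb{R}$ and every $\varepsilon>0$ there is a Lipschitz, $\mathcal{C}^1$-smooth function $K:X\to\mathbb{R}$ with $|f(x)-K(x)|<\varepsilon$ for all $x\in X$ and $\operatorname{Lip}(K)\le C_0\operatorname{Lip}(f)$. $\operatorname{Lip}(h)$ denotes the Lipschitz constant of $h$. *)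

(* Defs.v *)
From Stdlib Require Import Reals Lra.
Open Scope R_scope.
Set Implicit Arguments.

Record Banach := {
  car :> Type;
  vzero : car;
  vadd : car -> car -> car;
  vopp : car -> car;
  vscal : R -> car -> car;
  vnorm : car -> R;
  vadd_assoc : forall x y z, vadd x (vadd y z) = vadd (vadd x y) z;
  vadd_comm : forall x y, vadd x y = vadd y x;
  vadd_0 : forall x, vadd x vzero = x;
  vadd_opp : forall x, vadd x (vopp x) = vzero;
  vscal_assoc : forall a b x, vscal a (vscal b x) = vscal (a * b) x;
  vscal_1 : forall x, vscal 1 x = x;
  vscal_distr_v : forall a x y, vscal a (vadd x y) = vadd (vscal a x) (vscal a y);
  vscal_distr_s : forall a b x, vscal (a + b) x = vadd (vscal a x) (vscal b x);
  vnorm_eq0 : forall x, vnorm x = 0 -> x = vzero;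
  vnorm_triangle : forall x y, vnorm (vadd x y) <= vnorm x + vnorm y;
  vnorm_scal : forall a x, vnorm (vscal a x) = Rabs a * vnorm x;
  vcomplete : forall u : nat -> car,
    (forall eps, 0 < eps -> exists N, forall m n, (N <= m)%nat -> (N <= n)%nat ->
        vnorm (vadd (u m) (vopp (u n))) < eps) ->
    exists l, forall eps, 0 < eps -> exists N, forall n, (N <= n)%nat ->
        vnorm (vadd (u n) (vopp l)) < eps
}.

Section Defs.
Variable X : Banach.

Definition vsub (x y : X) : X := vadd X x (vopp X y).

Definition whole : X -> Prop := fun _ => True.

Definition closed_subspace (Y : X -> Prop) : Prop :=
  Y (vzero X) /\
  (forall x y, Y x -> Y y -> Y (vadd X x y)) /\
  (forall a x, Y x -> Y (vscal X a x)) /\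
  (forall (u : nat -> X) (l : X), (forall n, Y (u n)) ->
     (forall eps, 0 < eps -> exists N, forall n, (N <= n)%nat ->
        vnorm X (vsub (u n) l) < eps) -> Y l).

Definition bounded_linear_on (S : X -> Prop) (L : X -> R) : Prop :=
  (forall h k, S h -> S k -> L (vadd X h k) = L h + L k) /\
  (forall a h, S h -> L (vscal X a h) = a * L h) /\
  (exists M, forall h, S h -> Rabs (L h) <= M * vnorm X h).

(** Fréchet derivative at y of f, where f is regarded as a function on the
    normed space S (a linear subspace of X with the induced norm). *)
Definition frechet_deriv_on (S : X -> Prop) (f : X -> R) (y : X) (L : X -> R) : Prop :=
  bounded_linear_on S L /\
  (forall eps, 0 < eps -> exists delta, 0 < delta /\
     forall h, S h -> vnorm X h < delta ->
       Rabs (f (vadd X y h) - f y - L h) <= eps * vnorm X h).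

(** f : S -> R is C^1-smooth: Fréchet differentiable at every point of S,
    with derivative S -> S^* continuous for the operator (dual) norm. *)
Definition C1_on (S : X -> Prop) (f : X -> R) : Prop :=
  exists D : X -> X -> R,
    (forall y, S y -> frechet_deriv_on S f y (D y)) /\
    (forall y, S y -> forall eps, 0 < eps -> exists delta, 0 < delta /\
       forall z, S z -> vnorm X (vsub z y) < delta ->
         forall h, S h -> Rabs (D z h - D y h) <= eps * vnorm X h).

Definition lipschitz_with (S : X -> Prop) (f : X -> R) (L : R) : Prop :=
  0 <= L /\ forall x y, S x -> S y -> Rabs (f x - f y) <= L * vnorm X (vsub x y).

(** Property "star". Since Lip(f) is attained (f is Lip(f)-Lipschitz), the
    condition "Lip(K) <= C0 Lip(f)" is expressed as: for every L such that
    f is L-Lipschitz, K is (C0*L)-Lipschitz. *)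
Definition property_star : Prop :=
  exists C0 : R, forall (f : X -> R) (L : R), lipschitz_with whole f L ->
    forall eps, 0 < eps -> exists K : X -> R,
      C1_on whole K /\ lipschitz_with whole K (C0 * L) /\
      (forall x, Rabs (f x - K x) < eps).

End Defs.

Arguments closed_subspace {X} Y.
Arguments bounded_linear_on {X} S L.
Arguments frechet_deriv_on {X} S f y L.
Arguments C1_on {X} S f.
Arguments lipschitz_with {X} S f L.
Arguments vsub {X} x y.

(* Main.v *)
(* Strict differentiability at every point of a subspace is the same as being C^1 there, and is
   a purely local two-point condition, so everything is done with local Lipschitz estimates.

   One step: given [f] C^1 on [Y] and [eps > 0], find [K] C^1 on [X] with [f - K] eps-Lipschitz
   on [Y] and, if [f] is L-Lipschitz, [Lip K <= C L].  Iterating on [f - K] with [eps] halved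
   each time and summing gives the extension; if [f] is not Lipschitz, one first step makes the
   remainder Lipschitz.

   For one step, near each [y] in [Y] take the Taylor polynomial of [f], extended by Hahn-Banach,
   plus a smooth approximation of a Lipschitz extension of the remainder.  A well-ordering of
   the centres makes [Y] a countable union of levels, the local pieces of level [n] being
   2^-n-separated, so that one cutoff per level suffices.  Level [n] is used only within about
   4^-n of [Y], where its pieces are 4^-n L-close to a Lipschitz extension [F] of [f]; farther
   away the glued function follows smooth approximations of [F] itself. *)

Require Import Defs.
From Stdlib Require Import Reals Lra Lia Psatz List Classical ClassicalEpsilon.
From mathcomp Require boolp wochoice classical_sets.
Open Scope R_scope.
Set Implicit Arguments.
Unset Strict Implicit.

(** * Vectors, strict differentiability and local Lipschitz bounds *)

(** [property_star] is the only source of smooth functions on [X], so cutoffs too are smoothed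
    distance functions, and one of width [w] has slope of order [C0 / w]. Summing a partition of
    unity with many terms would ruin the Lipschitz constant; instead two functions at a time are
    switched by a convex combination, which costs the slope of the cutoff times the gap between them
    ([llip_convex]). On [Y] the gap can be prescribed ([tol]), but off [Y] a local piece is close to
    [F] only in proportion to the distance from [Y]. Hence the thickness is quadratic in the scale:
    a gap of order [L * thickness n] against a slope [C0 / scale n] costs order [C0 * L * scale n],
    which is summable. Leaving the neighbourhood of [Y] happens over width [thickness n], at a cost
    of order [C0 * L] that is not summable; but the shells where the cutoffs [theta n] vary are
    disjoint, so it is paid once. For one step [450 = 2 + 224 + 224]: the unswitched functions, one
    switch by [theta], all switches by [a]. Summing the iteration doubles this to [900]. *)

Section VectorTerms.
Variable X : Banach.

Lemma vscal_0 (x : X) : vscal X 0 x = vzero X.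
Proof.
  assert (E : vadd X (vscal X 0 x) (vscal X 0 x) = vscal X 0 x).
  { rewrite <- vscal_distr_s. f_equal. lra. }
  rewrite <- (vadd_opp X (vscal X 0 x)). rewrite <- E at 2.
  rewrite <- vadd_assoc, vadd_opp, vadd_0. reflexivity.
Qed.

Lemma vopp_scal (x : X) : vopp X x = vscal X (-1) x.
Proof.
  assert (E : vadd X x (vscal X (-1) x) = vzero X).
  { rewrite <- (vscal_1 X x) at 1. rewrite <- vscal_distr_s.
    replace (1 + -1) with 0 by lra. apply vscal_0. }
  rewrite <- (vadd_0 X (vopp X x)), <- E, vadd_assoc.
  rewrite (vadd_comm X (vopp X x)), vadd_opp, vadd_comm, vadd_0. reflexivity.
Qed.

(** Reflection: a linear expression in a list of atoms is determined by its real coefficients, so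
    identities in [X] reduce to identities in [R]. *)
Inductive vterm :=
  | tvar (n : nat)
  | tzero
  | tadd (a b : vterm)
  | topp (a : vterm)
  | tsub (a b : vterm)
  | tscal (r : R) (a : vterm).

Fixpoint teval (env : list X) (t : vterm) : X :=
  match t with
  | tvar n => nth n env (vzero X)
  | tzero => vzero X
  | tadd a b => vadd X (teval env a) (teval env b)
  | topp a => vopp X (teval env a)
  | tsub a b => vsub (teval env a) (teval env b)
  | tscal r a => vscal X r (teval env a)
  end.

Fixpoint tcoef (t : vterm) (i : nat) : R :=
  match t with
  | tvar n => if Nat.eqb n i then 1 else 0
  | tzero => 0
  | tadd a b => tcoef a i + tcoef b i
  | topp a => - tcoef a i
  | tsub a b => tcoef a i - tcoef b i
  | tscal r a => r * tcoef a i
  end.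

Fixpoint lincomb (c : nat -> R) (env : list X) : X :=
  match env with
  | nil => vzero X
  | x :: l => vadd X (vscal X (c O) x) (lincomb (fun i => c (S i)) l)
  end.

(** A recursive conjunction, so that computation on a known list of atoms leaves one real equation
    per atom. *)
Fixpoint coefs_eq (c1 c2 : nat -> R) (n : nat) : Prop :=
  match n with
  | O => True
  | S m => c1 O = c2 O /\ coefs_eq (fun i => c1 (S i)) (fun i => c2 (S i)) m
  end.

Lemma lincomb_ext env : forall c1 c2, coefs_eq c1 c2 (length env) ->
  lincomb c1 env = lincomb c2 env.
Proof.
  induction env as [|x l IH]; simpl; intros c1 c2 H; [reflexivity|].
  destruct H as [-> H]. f_equal. now apply IH.
Qed.

Lemma coefs_eq_ext n : forall c1 c2, (forall i, c1 i = c2 i) -> coefs_eq c1 c2 n.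
Proof. induction n; simpl; intros; auto. Qed.

Lemma lincomb_add env : forall c1 c2,
  lincomb (fun i => c1 i + c2 i) env = vadd X (lincomb c1 env) (lincomb c2 env).
Proof.
  induction env as [|x l IH]; simpl; intros c1 c2; [now rewrite vadd_0|].
  rewrite IH, vscal_distr_s, <- !vadd_assoc. f_equal.
  rewrite !vadd_assoc. f_equal. apply vadd_comm.
Qed.

Lemma vscal_zero (a : R) : vscal X a (vzero X) = vzero X.
Proof. rewrite <- (vscal_0 (vzero X)), vscal_assoc. f_equal. lra. Qed.

Lemma lincomb_scal env r : forall c,
  lincomb (fun i => r * c i) env = vscal X r (lincomb c env).
Proof.
  induction env as [|x l IH]; simpl; intros c; [now rewrite vscal_zero|].
  now rewrite IH, vscal_distr_v, vscal_assoc.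
Qed.

Lemma lincomb_0 env : lincomb (fun _ => 0) env = vzero X.
Proof.
  induction env as [|x l IH]; simpl; [reflexivity|].
  now rewrite IH, vscal_0, vadd_0.
Qed.

Lemma lincomb_var env : forall n,
  lincomb (fun i => if Nat.eqb n i then 1 else 0) env = nth n env (vzero X).
Proof.
  induction env as [|x l IH]; simpl; intros [|n]; simpl; try reflexivity.
  - rewrite lincomb_0, vscal_1. apply vadd_0.
  - rewrite IH, vscal_0, vadd_comm. apply vadd_0.
Qed.

Lemma teval_lincomb env t : teval env t = lincomb (tcoef t) env.
Proof.
  induction t; simpl.
  - symmetry. apply lincomb_var.
  - symmetry. apply lincomb_0.
  - rewrite IHt1, IHt2. symmetry. apply lincomb_add.
  - rewrite IHt, vopp_scal, <- lincomb_scal. apply lincomb_ext, coefs_eq_ext.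
    intros; lra.
  - unfold vsub. rewrite IHt1, IHt2, vopp_scal, <- lincomb_scal, <- lincomb_add.
    apply lincomb_ext, coefs_eq_ext. intros; lra.
  - rewrite IHt. symmetry. apply lincomb_scal.
Qed.

Lemma teval_eq env t1 t2 : coefs_eq (tcoef t1) (tcoef t2) (length env) ->
  teval env t1 = teval env t2.
Proof. rewrite !teval_lincomb. apply lincomb_ext. Qed.

End VectorTerms.

Ltac vindex x env :=
  lazymatch env with
  | x :: _ => constr:(O)
  | _ :: ?l => let n := vindex x l in constr:(S n)
  end.

Ltac vmem x env :=
  lazymatch env with
  | nil => constr:(false)
  | x :: _ => constr:(true)
  | _ :: ?l => vmem x l
  end.

Ltac vatoms env t :=
  lazymatch t with
  | vzero _ => env
  | vadd _ ?a ?b => let e := vatoms env a in vatoms e b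
  | vopp _ ?a => vatoms env a
  | vsub ?a ?b => let e := vatoms env a in vatoms e b
  | vscal _ _ ?a => vatoms env a
  | _ => lazymatch vmem t env with true => env | false => constr:(t :: env) end
  end.

Ltac vreify env t :=
  lazymatch t with
  | vzero _ => constr:(tzero)
  | vadd _ ?a ?b => let u := vreify env a in let v := vreify env b in constr:(tadd u v)
  | vopp _ ?a => let u := vreify env a in constr:(topp u)
  | vsub ?a ?b => let u := vreify env a in let v := vreify env b in constr:(tsub u v)
  | vscal _ ?r ?a => let u := vreify env a in constr:(tscal r u)
  | _ => let n := vindex t env in constr:(tvar n)
  end.

(* Decides linear vector identities by comparing coefficients atom by atom. *)
Ltac vec :=
  lazymatch goal with
  | |- @eq (car ?X) ?a ?b =>
    let e0 := vatoms (@nil (car X)) a in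
    let env := vatoms e0 b in
    let u := vreify env a in
    let v := vreify env b in
    change (@teval X env u = @teval X env v);
    apply teval_eq; cbn; repeat split; try ring; try (field; lra)
  end.

(** * Distance, neighbourhoods and segments *)

Definition dist {X : Banach} (x y : X) : R := vnorm X (vsub x y).
Definition subspace {X : Banach} (S : X -> Prop) : Prop :=
  S (vzero X) /\ (forall x y, S x -> S y -> S (vadd X x y)) /\
  (forall a x, S x -> S (vscal X a x)).
Definition near {X : Banach} (x : X) (P : X -> Prop) : Prop :=
  exists r, 0 < r /\ forall u, dist u x < r -> P u.

Section Metric.
Variable X : Banach.
Implicit Types x y z u v h : X.

Lemma vnorm_zero : vnorm X (vzero X) = 0.
Proof. rewrite <- (vscal_0 (vzero X)), vnorm_scal, Rabs_R0. ring. Qed.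

Lemma vnorm_opp x : vnorm X (vopp X x) = vnorm X x.
Proof. rewrite vopp_scal, vnorm_scal, Rabs_left by lra. ring. Qed.

Lemma vnorm_ge0 x : 0 <= vnorm X x.
Proof.
  pose proof (vnorm_triangle X x (vopp X x)) as H.
  rewrite vadd_opp, vnorm_zero, vnorm_opp in H. lra.
Qed.

Lemma dist_ge0 x y : 0 <= dist x y.
Proof. apply vnorm_ge0. Qed.

Lemma dist_sym x y : dist x y = dist y x.
Proof. unfold dist. rewrite <- vnorm_opp. f_equal. vec. Qed.

Lemma dist_tri x y z : dist x z <= dist x y + dist y z.
Proof.
  unfold dist. eapply Rle_trans; [|apply vnorm_triangle].
  right. f_equal. vec.
Qed.

Lemma dist_xx x : dist x x = 0.
Proof.
  unfold dist. replace (vsub x x) with (vzero X) by vec. apply vnorm_zero.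
Qed.

Lemma dist_0 x : dist x (vzero X) = vnorm X x.
Proof. unfold dist. f_equal. vec. Qed.

Lemma dist_addl x h : dist (vadd X x h) x = vnorm X h.
Proof. unfold dist. f_equal. vec. Qed.

Lemma near_and x (P Q : X -> Prop) :
  near x P -> near x Q -> near x (fun u => P u /\ Q u).
Proof.
  intros [r [Hr H]] [s [Hs H']]. exists (Rmin r s). split.
  - now apply Rmin_glb_lt.
  - intros u Hu. pose proof (Rmin_l r s). pose proof (Rmin_r r s).
    split; [apply H | apply H']; lra.
Qed.

Lemma near_imp x (P Q : X -> Prop) : (forall u, P u -> Q u) -> near x P -> near x Q.
Proof. intros HPQ [r [Hr H]]. exists r. auto. Qed.

Lemma near_ball x r : 0 < r -> near x (fun u => dist u x < r).
Proof. intros Hr. exists r. auto. Qed.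

Lemma near_at x (P : X -> Prop) : near x P -> P x.
Proof. intros [r [Hr H]]. apply H. now rewrite dist_xx. Qed.

Lemma near_dist_lt x v r : dist x v < r -> near x (fun u => dist u v < r).
Proof.
  intros H. exists (r - dist x v). split; [lra|]. intros u Hu.
  pose proof (dist_tri u x v). lra.
Qed.

Lemma near_true x (P : X -> Prop) : (forall u, P u) -> near x P.
Proof. intros H. exists 1. split; [lra | auto]. Qed.

Lemma near_dist_ge x (V : X -> Prop) r s : s < r ->
  (forall v, V v -> r <= dist x v) ->
  near x (fun u => forall v, V v -> s <= dist u v).
Proof.
  intros Hsr H. exists (r - s). split; [lra|]. intros u Hu v Hv.
  pose proof (dist_tri x u v). rewrite (dist_sym x u) in *. specialize (H v Hv). lra.
Qed.

Lemma whole_subspace : subspace (whole X).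
Proof. repeat split. Qed.

Lemma subspace_sub (S : X -> Prop) x y : subspace S -> S x -> S y -> S (vsub x y).
Proof.
  intros [H0 [Ha Hs]] Hx Hy.
  replace (vsub x y) with (vadd X x (vscal X (-1) y)) by vec. auto.
Qed.

Definition seg x y t : X := vadd X x (vscal X t (vsub y x)).

Lemma subspace_seg (S : X -> Prop) x y t : subspace S -> S x -> S y -> S (seg x y t).
Proof.
  intros HS Hx Hy. pose proof (subspace_sub HS Hy Hx).
  destruct HS as [_ [Ha Hs]]. unfold seg. auto.
Qed.

Lemma seg_dist x y s t : dist (seg x y s) (seg x y t) = Rabs (s - t) * dist y x.
Proof. unfold dist. rewrite <- vnorm_scal. f_equal. unfold seg. vec. Qed.

Lemma seg_ball x y z t r : 0 <= t <= 1 -> dist x z < r -> dist y z < r ->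
  dist (seg x y t) z < r.
Proof.
  intros Ht Hx Hy.
  assert (E : dist (seg x y t) z <= (1 - t) * dist x z + t * dist y z).
  { pose proof (vnorm_triangle X (vscal X (1 - t) (vsub x z)) (vscal X t (vsub y z))) as T.
    rewrite !vnorm_scal, !Rabs_pos_eq in T by lra.
    eapply Rle_trans; [|exact T]. right. unfold dist. f_equal. unfold seg. vec. }
  destruct (Req_dec t 0) as [->|]; [lra|]. nra.
Qed.

End Metric.

(* Supremum argument: the set of [t] such that the bound holds on [0, t] is closed and
   relatively open. *)
Lemma real_lip_of_pointwise (g : R -> R) (K : R) :
  (forall t, 0 <= t <= 1 -> exists r, 0 < r /\ forall s, 0 <= s <= 1 ->
     Rabs (s - t) < r -> Rabs (g s - g t) <= K * Rabs (s - t)) ->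
  Rabs (g 1 - g 0) <= K.
Proof.
  intros H.
  set (E := fun t => 0 <= t <= 1 /\ forall s, 0 <= s <= t -> Rabs (g s - g 0) <= K * s).
  assert (E0 : E 0).
  { split; [lra|]. intros s Hs. replace s with 0 by lra.
    rewrite Rminus_diag, Rabs_R0. lra. }
  destruct (completeness E) as [c [Hub Hlub]].
  { exists 1. intros t [Ht _]. lra. }
  { now exists 0. }
  assert (Hc : 0 <= c <= 1).
  { split; [now apply Hub|]. apply Hlub. intros t [Ht _]. lra. }
  destruct (H c Hc) as [r [Hr Hloc]].
  assert (below : forall s, 0 <= s < c -> Rabs (g s - g 0) <= K * s).
  { intros s Hs. assert (Ht : exists t, E t /\ s < t).
    { apply NNPP. intros Hn. assert (c <= s); [|lra].
      apply Hlub. intros t Ht. apply Rnot_lt_le. intros Hlt. apply Hn. now exists t. }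
    destruct Ht as [t [[_ Ht] Hst]]. apply Ht. lra. }
  assert (at_c : Rabs (g c - g 0) <= K * c).
  { destruct (Req_dec c 0) as [->|Hc0]; [apply E0; lra|].
    set (s := Rmax 0 (c - r / 2)).
    assert (Hs : 0 <= s < c /\ c - s < r).
    { unfold s. destruct (Rle_dec 0 (c - r / 2)).
      - rewrite Rmax_right; lra.
      - rewrite Rmax_left; lra. }
    assert (A1 : Rabs (g s - g c) <= K * Rabs (s - c)).
    { apply Hloc; [lra|]. rewrite Rabs_left1; lra. }
    rewrite (Rabs_left1 (s - c)) in A1 by lra.
    specialize (below s ltac:(lra)).
    replace (g c - g 0) with ((g s - g 0) - (g s - g c)) by ring.
    eapply Rle_trans; [apply Rabs_triang|]. rewrite Rabs_Ropp. lra. }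
  set (c' := Rmin 1 (c + r / 2)).
  assert (Hc' : c' <= 1 /\ c' <= c + r / 2) by (split; [apply Rmin_l | apply Rmin_r]).
  assert (Hcc' : c <= c') by (apply Rmin_glb; lra).
  assert (EC : E c').
  { split; [lra|]. intros s Hs. destruct (Rlt_le_dec s c) as [Hsc|Hsc].
    - apply below. lra.
    - assert (A2 : Rabs (g s - g c) <= K * Rabs (s - c)).
      { apply Hloc; [lra|]. rewrite Rabs_pos_eq; lra. }
      rewrite (Rabs_pos_eq (s - c)) in A2 by lra.
      replace (g s - g 0) with ((g s - g c) + (g c - g 0)) by ring.
      eapply Rle_trans; [apply Rabs_triang|]. lra. }
  assert (c1 : c = 1).
  { pose proof (Hub c' EC). destruct (Rle_dec 1 (c + r / 2)).
    - unfold c' in *. rewrite Rmin_left in * by lra. lra.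
    - unfold c' in *. rewrite Rmin_right in * by lra. lra. }
  rewrite c1 in at_c. lra.
Qed.


(** * Local Lipschitz bounds and the calculus of strictly differentiable functions *)

Definition llip {X : Banach} (S : X -> Prop) (f : X -> R) (x : X) (M : R) : Prop :=
  exists r, 0 < r /\ forall u v, S u -> S v -> dist u x < r -> dist v x < r ->
    Rabs (f u - f v) <= M * dist u v.

(* Strict differentiability: unlike Frechet differentiability it is a local condition at a
   single point which already encodes continuity of the derivative. *)
Definition sdiff {X : Banach} (S : X -> Prop) (f : X -> R) (x : X) (D : X -> R) : Prop :=
  bounded_linear_on S D /\
  forall eps, 0 < eps -> llip S (fun u => f u - D u) x eps.

Definition smooth {X : Banach} (S : X -> Prop) (f : X -> R) (x : X) : Prop :=
  exists D, sdiff S f x D.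

Section Calculus.
Variable X : Banach.
Variable S : X -> Prop.
Hypothesis HS : subspace S.
Implicit Types (x y z u v h : X) (f g : X -> R).

(** Restriction to the segment reduces this to [real_lip_of_pointwise]. Only comparisons with the
    base point are required, which is what a Frechet derivative supplies. *)
Lemma pointwise_lip f u v K : S u -> S v ->
  (forall t, 0 <= t <= 1 -> near (seg u v t) (fun w => S w ->
     Rabs (f w - f (seg u v t)) <= K * dist w (seg u v t))) ->
  Rabs (f u - f v) <= K * dist u v.
Proof.
  intros Hu Hv H.
  assert (E : Rabs (f (seg u v 1) - f (seg u v 0)) <= K * dist v u).
  { apply real_lip_of_pointwise with (g := fun t => f (seg u v t)). intros t Ht.
    destruct (H t Ht) as [r [Hr Hloc]].
    pose proof (dist_ge0 v u) as Hd.
    (* The added 1 keeps the denominator positive when [u = v]. *)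
    exists (r / (dist v u + 1)). split; [apply Rdiv_lt_0_compat; lra|].
    intros s Hs Hst.
    rewrite Rmult_assoc, (Rmult_comm (dist v u)), <- (seg_dist u v s t).
    apply Hloc; [|now apply subspace_seg].
    rewrite seg_dist. pose proof (Rabs_pos (s - t)).
    assert (Rabs (s - t) * (dist v u + 1) < r).
    { apply Rmult_lt_reg_r with (/ (dist v u + 1)).
      - apply Rinv_0_lt_compat. lra.
      - rewrite Rmult_assoc, Rinv_r, Rmult_1_r by lra. exact Hst. }
    nra. }
  replace (seg u v 1) with v in E by (unfold seg; vec).
  replace (seg u v 0) with u in E by (unfold seg; vec).
  rewrite Rabs_minus_sym, dist_sym. exact E.
Qed.

Lemma llip_pointwise f x M : S x -> llip S f x M ->
  near x (fun w => S w -> Rabs (f w - f x) <= M * dist w x).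
Proof.
  intros Hx [r [Hr H]]. exists r. split; [assumption|]. intros w Hw Sw.
  apply H; auto. now rewrite dist_xx.
Qed.

Lemma lip_of_llip f M : (forall x, S x -> llip S f x M) ->
  forall u v, S u -> S v -> Rabs (f u - f v) <= M * dist u v.
Proof.
  intros H u v Hu Hv. apply pointwise_lip; auto. intros t Ht.
  apply llip_pointwise; [|apply H]; now apply subspace_seg.
Qed.

Lemma llip_weaken f x M M' : M <= M' -> llip S f x M -> llip S f x M'.
Proof.
  intros HM [r [Hr H]]. exists r. split; [assumption|]. intros u v Su Sv Hu Hv.
  pose proof (dist_ge0 u v). specialize (H u v Su Sv Hu Hv). nra.
Qed.

Lemma llip_congr f g x M : near x (fun u => S u -> f u = g u) -> llip S g x M -> llip S f x M.
Proof.
  intros [r [Hr E]] [s [Hs H]]. exists (Rmin r s).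
  split; [now apply Rmin_glb_lt|]. intros u v Su Sv Hu Hv.
  pose proof (Rmin_l r s). pose proof (Rmin_r r s).
  rewrite !E by (auto; lra). apply H; auto; lra.
Qed.

Lemma llip_add f g x M N : llip S f x M -> llip S g x N ->
  llip S (fun u => f u + g u) x (M + N).
Proof.
  intros [r [Hr Hf]] [s [Hs Hg]]. exists (Rmin r s).
  split; [now apply Rmin_glb_lt|]. intros u v Su Sv Hu Hv.
  pose proof (Rmin_l r s). pose proof (Rmin_r r s).
  specialize (Hf u v Su Sv ltac:(lra) ltac:(lra)).
  specialize (Hg u v Su Sv ltac:(lra) ltac:(lra)).
  replace (f u + g u - (f v + g v)) with ((f u - f v) + (g u - g v)) by ring.
  eapply Rle_trans; [apply Rabs_triang|]. lra.
Qed.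

Lemma llip_scal f x M c : llip S f x M -> llip S (fun u => c * f u) x (Rabs c * M).
Proof.
  intros [r [Hr H]]. exists r. split; [assumption|]. intros u v Su Sv Hu Hv.
  rewrite <- Rmult_minus_distr_l, Rabs_mult, Rmult_assoc.
  apply Rmult_le_compat_l; [apply Rabs_pos | auto].
Qed.

Lemma llip_sub f g x M N : llip S f x M -> llip S g x N ->
  llip S (fun u => f u - g u) x (M + N).
Proof.
  intros Hf Hg. apply llip_weaken with (M + Rabs (-1) * N).
  { rewrite Rabs_left; lra. }
  apply llip_congr with (fun u => f u + (-1) * g u).
  { apply near_true. intros; ring. }
  apply llip_add; [assumption|]. now apply llip_scal.
Qed.

Lemma llip_of_lip f x M : (forall u v, S u -> S v -> Rabs (f u - f v) <= M * dist u v) ->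
  llip S f x M.
Proof. intros H. exists 1. split; [lra|]. auto. Qed.

(* The estimate behind the gluing: passing between [f] and [g] by a cutoff [a] costs only
   the Lipschitz constant of [a] times the gap between [f] and [g]. *)
Lemma llip_convex a f g x A M e : 0 <= A ->
  llip S a x A -> near x (fun u => S u -> 0 <= a u <= 1) ->
  llip S f x M -> llip S g x M -> near x (fun u => S u -> Rabs (f u - g u) <= e) ->
  llip S (fun u => a u * f u + (1 - a u) * g u) x (M + A * e).
Proof.
  intros HA [r1 [Hr1 Ha]] [r2 [Hr2 H01]] [r3 [Hr3 Hf]] [r4 [Hr4 Hg]] [r5 [Hr5 He]].
  exists (Rmin (Rmin r1 r2) (Rmin (Rmin r3 r4) r5)).
  split; [repeat apply Rmin_glb_lt; assumption|]. intros u v Su Sv Hu Hv.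
  assert (B : forall w, dist w x < Rmin (Rmin r1 r2) (Rmin (Rmin r3 r4) r5) ->
    dist w x < r1 /\ dist w x < r2 /\ dist w x < r3 /\ dist w x < r4 /\ dist w x < r5).
  { intros w. generalize (dist w x). intros t Ht.
    unfold Rmin in Ht. repeat destruct Rle_dec; lra. }
  apply B in Hu. apply B in Hv.
  specialize (Ha u v Su Sv ltac:(lra) ltac:(lra)).
  specialize (Hf u v Su Sv ltac:(lra) ltac:(lra)).
  specialize (Hg u v Su Sv ltac:(lra) ltac:(lra)).
  specialize (H01 u ltac:(lra) Su). specialize (He v ltac:(lra) Sv).
  replace (a u * f u + (1 - a u) * g u - (a v * f v + (1 - a v) * g v))
    with (a u * (f u - f v) + (1 - a u) * (g u - g v) + (a u - a v) * (f v - g v)) by ring.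
  eapply Rle_trans; [apply Rabs_triang|].
  eapply Rle_trans; [apply Rplus_le_compat_r, Rabs_triang|].
  rewrite !Rabs_mult, (Rabs_pos_eq (a u)), (Rabs_pos_eq (1 - a u)) by lra.
  assert (Rabs (a u - a v) * Rabs (f v - g v) <= A * dist u v * e).
  { apply Rmult_le_compat; auto using Rabs_pos. }
  nra.
Qed.

Lemma bounded_linear_sub D u v : bounded_linear_on S D -> S u -> S v ->
  D (vsub u v) = D u - D v.
Proof.
  intros [Ha [Hs _]] Hu Hv. destruct HS as [_ [_ HSs]].
  replace (vsub u v) with (vadd X u (vscal X (-1) v)) by vec.
  rewrite Ha, Hs by auto. ring.
Qed.

Lemma bounded_linear_lip D : bounded_linear_on S D ->
  exists M, 0 <= M /\ forall u v, S u -> S v -> Rabs (D u - D v) <= M * dist u v.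
Proof.
  intros HD. pose proof HD as [_ [_ [M HM]]]. exists (Rabs M).
  split; [apply Rabs_pos|]. intros u v Hu Hv.
  rewrite <- bounded_linear_sub by assumption.
  eapply Rle_trans; [apply HM; now apply subspace_sub|].
  apply Rmult_le_compat_r; [apply vnorm_ge0 | apply Rle_abs].
Qed.

Lemma smooth_llip f x : smooth S f x -> exists M, 0 <= M /\ llip S f x M.
Proof.
  intros [D [HD H]]. destruct (bounded_linear_lip HD) as [M [HM HL]].
  exists (1 + M). split; [lra|].
  apply llip_congr with (fun u => (f u - D u) + D u).
  { apply near_true. intros; ring. }
  apply llip_add; [apply H; lra | now apply llip_of_lip].
Qed.

Lemma bounded_linear_add D E : bounded_linear_on S D -> bounded_linear_on S E ->
  bounded_linear_on S (fun u => D u + E u).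
Proof.
  intros [Da [Ds [M DM]]] [Ea [Es [N EN]]]. repeat split.
  - intros h k Hh Hk. rewrite Da, Ea by assumption. ring.
  - intros a h Hh. rewrite Ds, Es by assumption. ring.
  - exists (M + N). intros h Hh. eapply Rle_trans; [apply Rabs_triang|].
    specialize (DM h Hh). specialize (EN h Hh). lra.
Qed.

Lemma bounded_linear_scal D c : bounded_linear_on S D ->
  bounded_linear_on S (fun u => c * D u).
Proof.
  intros [Da [Ds [M DM]]]. repeat split.
  - intros h k Hh Hk. rewrite Da by assumption. ring.
  - intros a h Hh. rewrite Ds by assumption. ring.
  - exists (Rabs c * M). intros h Hh. rewrite Rabs_mult, Rmult_assoc.
    apply Rmult_le_compat_l; [apply Rabs_pos | auto].
Qed.

Lemma bounded_linear_0 : bounded_linear_on S (fun _ => 0).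
Proof.
  repeat split; intros; try ring. exists 0. intros. rewrite Rabs_R0. lra.
Qed.

Lemma smooth_congr f g x : near x (fun u => S u -> f u = g u) -> smooth S g x -> smooth S f x.
Proof.
  intros E [D [HD H]]. exists D. split; [assumption|]. intros eps Heps.
  apply llip_congr with (fun u => g u - D u); [|now apply H].
  revert E. apply near_imp. intros u Hu Su. now rewrite Hu.
Qed.

Lemma smooth_const c x : smooth S (fun _ => c) x.
Proof.
  exists (fun _ => 0). split; [apply bounded_linear_0|]. intros eps Heps.
  apply llip_of_lip. intros u v _ _. rewrite Rminus_diag, Rabs_R0.
  pose proof (dist_ge0 u v). nra.
Qed.

Lemma smooth_linear D x : bounded_linear_on S D -> smooth S D x.
Proof.
  intros HD. exists D. split; [assumption|]. intros eps Heps.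
  apply llip_of_lip. intros u v _ _. rewrite !Rminus_diag, Rabs_R0.
  pose proof (dist_ge0 u v). nra.
Qed.

Lemma smooth_add f g x : smooth S f x -> smooth S g x -> smooth S (fun u => f u + g u) x.
Proof.
  intros [D [HD Hf]] [E [HE Hg]]. exists (fun u => D u + E u).
  split; [now apply bounded_linear_add|]. intros eps Heps.
  apply llip_congr with (fun u => (f u - D u) + (g u - E u)).
  { apply near_true. intros; ring. }
  replace eps with (eps / 2 + eps / 2) by field.
  apply llip_add; [apply Hf | apply Hg]; lra.
Qed.

Lemma smooth_scal f x c : smooth S f x -> smooth S (fun u => c * f u) x.
Proof.
  intros [D [HD Hf]]. exists (fun u => c * D u).
  split; [now apply bounded_linear_scal|]. intros eps Heps.
  pose proof (Rabs_pos c).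
  apply llip_weaken with (Rabs c * (eps / (Rabs c + 1))).
  { apply Rmult_le_reg_r with (Rabs c + 1); [lra|]. field_simplify; lra. }
  apply llip_congr with (fun u => c * (f u - D u)).
  { apply near_true. intros; ring. }
  apply llip_scal, Hf, Rdiv_lt_0_compat; lra.
Qed.

Lemma smooth_sub f g x : smooth S f x -> smooth S g x -> smooth S (fun u => f u - g u) x.
Proof.
  intros Hf Hg. apply smooth_congr with (fun u => f u + (-1) * g u).
  { apply near_true. intros; ring. }
  now apply smooth_add, smooth_scal.
Qed.

Lemma smooth_mul f g x : S x -> smooth S f x -> smooth S g x ->
  smooth S (fun u => f u * g u) x.
Proof.
  intros Sx Sf Sg. destruct (smooth_llip Sf) as [M [HM Lf]].
  destruct (smooth_llip Sg) as [N [HN Lg]].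
  destruct Sf as [D [HD Hf]]. destruct Sg as [E [HE Hg]].
  exists (fun u => f x * E u + g x * D u).
  split; [now apply bounded_linear_add; apply bounded_linear_scal|]. intros eps Heps.
  pose proof (Rabs_pos (f x)) as Pf. pose proof (Rabs_pos (g x)) as Pg.
  set (e := eps / (4 * (Rabs (f x) + Rabs (g x) + 1))).
  assert (He : 0 < e) by (apply Rdiv_lt_0_compat; lra).
  assert (Hee : (Rabs (f x) + Rabs (g x)) * e <= eps / 4).
  { replace (eps / 4) with ((Rabs (f x) + Rabs (g x) + 1) * e) by (unfold e; field; lra).
    nra. }
  set (rho := eps / (4 * (M * N + 1))).
  assert (HMN : 0 <= M * N) by nra.
  assert (Hrho : 0 < rho) by (apply Rdiv_lt_0_compat; lra).
  assert (Hrr : M * N * rho <= eps / 4).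
  { replace (eps / 4) with ((M * N + 1) * rho) by (unfold rho; field; lra). nra. }
  destruct (Hf e He) as [r1 [Hr1 H1]]. destruct (Hg e He) as [r2 [Hr2 H2]].
  destruct Lf as [r3 [Hr3 H3]]. destruct Lg as [r4 [Hr4 H4]].
  exists (Rmin (Rmin r1 r2) (Rmin (Rmin r3 r4) rho)).
  split; [repeat apply Rmin_glb_lt; assumption|]. intros u v Su Sv Hu Hv.
  assert (B : forall w, dist w x < Rmin (Rmin r1 r2) (Rmin (Rmin r3 r4) rho) ->
    dist w x < r1 /\ dist w x < r2 /\ dist w x < r3 /\ dist w x < r4 /\ dist w x < rho).
  { intros w. generalize (dist w x). intros t Ht.
    unfold Rmin in Ht. repeat destruct Rle_dec; lra. }
  apply B in Hu. apply B in Hv.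
  specialize (H1 u v Su Sv ltac:(lra) ltac:(lra)).
  specialize (H2 u v Su Sv ltac:(lra) ltac:(lra)).
  pose proof (H3 u v Su Sv ltac:(lra) ltac:(lra)) as F1.
  pose proof (H3 v x Sv Sx ltac:(lra) ltac:(rewrite dist_xx; lra)) as F2.
  pose proof (H4 u v Su Sv ltac:(lra) ltac:(lra)) as G1.
  pose proof (H4 u x Su Sx ltac:(lra) ltac:(rewrite dist_xx; lra)) as G2.
  pose proof (dist_ge0 u v) as Hd. pose proof (dist_ge0 u x). pose proof (dist_ge0 v x).
  (* Remainders of the two factors, weighted by values at [x], plus two products of increments; each
     product has one increment taken from [x], hence at most [M * rho] or [N * rho]. *)
  match goal with |- Rabs ?t <= _ => replace t with
    (g x * (f u - D u - (f v - D v)) + f x * (g u - E u - (g v - E v))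
     + ((f u - f v) * (g u - g x) + (f v - f x) * (g u - g v))) by ring end.
  assert (A1 : Rabs (g x * (f u - D u - (f v - D v))) <= Rabs (g x) * (e * dist u v)).
  { rewrite Rabs_mult. now apply Rmult_le_compat_l. }
  assert (A2 : Rabs (f x * (g u - E u - (g v - E v))) <= Rabs (f x) * (e * dist u v)).
  { rewrite Rabs_mult. now apply Rmult_le_compat_l. }
  assert (A3 : Rabs ((f u - f v) * (g u - g x)) <= M * dist u v * (N * rho)).
  { rewrite Rabs_mult. apply Rmult_le_compat; auto using Rabs_pos. nra. }
  assert (A4 : Rabs ((f v - f x) * (g u - g v)) <= M * rho * (N * dist u v)).
  { rewrite Rabs_mult. apply Rmult_le_compat; auto using Rabs_pos. nra. }
  eapply Rle_trans; [apply Rabs_triang|].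
  eapply Rle_trans; [apply Rplus_le_compat; apply Rabs_triang|]. nra.
Qed.

(** The simplest C^1 function that is flat on a half-line. All cutoffs are built from it, so
    composition with this one function replaces a general chain rule. *)
Definition posq (t : R) : R := Rmax 0 t * Rmax 0 t.

(** The derivative [2 * Rmax 0 c] is 2-Lipschitz in [c], which bounds the price of linearising at
    [c] instead of between [s] and [t]. *)
Lemma posq_remainder c s t :
  Rabs (posq s - posq t - 2 * Rmax 0 c * (s - t))
    <= 2 * (Rabs (s - c) + Rabs (t - c)) * Rabs (s - t).
Proof.
  unfold posq, Rmax, Rabs. repeat destruct Rle_dec; repeat destruct Rcase_abs; nra.
Qed.

Lemma smooth_posq f x : S x -> smooth S f x -> smooth S (fun u => posq (f u)) x.
Proof.
  intros Sx Sf. destruct (smooth_llip Sf) as [M [HM [r1 [Hr1 L]]]].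
  destruct Sf as [D [HD Hf]]. set (c := 2 * Rmax 0 (f x)).
  assert (Hc : 0 <= c) by (unfold c; pose proof (Rmax_l 0 (f x)); lra).
  exists (fun u => c * D u). split; [now apply bounded_linear_scal|]. intros eps Heps.
  set (e := eps / (2 * (c + 1))).
  assert (He : 0 < e) by (apply Rdiv_lt_0_compat; lra).
  assert (Hee : c * e <= eps / 2).
  { replace (eps / 2) with ((c + 1) * e) by (unfold e; field; lra). nra. }
  set (rho := eps / (8 * (M * M + 1))).
  assert (Hrho : 0 < rho) by (apply Rdiv_lt_0_compat; nra).
  assert (Hrr : M * M * rho <= eps / 8).
  { replace (eps / 8) with ((M * M + 1) * rho) by (unfold rho; field; nra). nra. }
  destruct (Hf e He) as [r2 [Hr2 H2]].
  exists (Rmin rho (Rmin r1 r2)).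
  split; [repeat apply Rmin_glb_lt; assumption|]. intros u v Su Sv Hu Hv.
  pose proof (Rmin_l rho (Rmin r1 r2)). pose proof (Rmin_r rho (Rmin r1 r2)).
  pose proof (Rmin_l r1 r2). pose proof (Rmin_r r1 r2).
  specialize (H2 u v Su Sv ltac:(lra) ltac:(lra)).
  pose proof (L u v Su Sv ltac:(lra) ltac:(lra)) as L1.
  pose proof (L u x Su Sx ltac:(lra) ltac:(rewrite dist_xx; lra)) as L2.
  pose proof (L v x Sv Sx ltac:(lra) ltac:(rewrite dist_xx; lra)) as L3.
  pose proof (dist_ge0 u v) as Hd.
  replace (posq (f u) - c * D u - (posq (f v) - c * D v)) with
    ((posq (f u) - posq (f v) - c * (f u - f v)) + c * (f u - D u - (f v - D v))) by ring.
  eapply Rle_trans; [apply Rabs_triang|]. rewrite Rabs_mult, (Rabs_pos_eq c) by assumption.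
  pose proof (posq_remainder (f x) (f u) (f v)) as Q. fold c in Q.
  assert (Q' : 2 * (Rabs (f u - f x) + Rabs (f v - f x)) * Rabs (f u - f v)
            <= 2 * (M * rho + M * rho) * (M * dist u v)).
  { apply Rmult_le_compat; auto using Rabs_pos.
    - pose proof (Rabs_pos (f u - f x)). pose proof (Rabs_pos (f v - f x)). lra.
    - assert (M * dist u x <= M * rho) by (apply Rmult_le_compat_l; lra).
      assert (M * dist v x <= M * rho) by (apply Rmult_le_compat_l; lra). lra. }
  assert (c * Rabs (f u - D u - (f v - D v)) <= c * (e * dist u v)).
  { now apply Rmult_le_compat_l. }
  nra.
Qed.

End Calculus.

(** * Strict differentiability on a subspace is the C^1 property *)

Section Frechet.
Variable X : Banach.
Variable S : X -> Prop.
Hypothesis HS : subspace S.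

(** At [z] the function [f - D x] has derivative [D z - D x], small near [x] by continuity; the mean
    value estimate on segments makes this a Lipschitz bound. *)
Lemma smooth_of_C1 f x : C1_on S f -> S x -> smooth S f x.
Proof.
  intros [D [HD Hcont]] Sx. exists (D x). split; [now apply HD|]. intros eps Heps.
  destruct (Hcont x Sx (eps / 2) ltac:(lra)) as [r [Hr Hc]].
  exists r. split; [assumption|]. intros u v Su Sv Hu Hv.
  apply (pointwise_lip HS (f := fun w => f w - D x w)); auto. intros t Ht.
  assert (Sz : S (seg u v t)) by now apply subspace_seg.
  assert (Hz : dist (seg u v t) x < r) by now apply seg_ball.
  set (z := seg u v t) in *. destruct (HD z Sz) as [HDz Hz'].
  destruct (Hz' (eps / 2) ltac:(lra)) as [s [Hs Hfr]].
  exists s. split; [assumption|]. intros w Hw Sw.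
  assert (Sh : S (vsub w z)) by now apply subspace_sub.
  specialize (Hfr _ Sh Hw). replace (vadd X z (vsub w z)) with w in Hfr by vec.
  specialize (Hc z Sz Hz _ Sh). fold (dist w z) in *.
  pose proof (bounded_linear_sub HS (proj1 (HD x Sx)) Sw Sz) as E.
  replace (f w - D x w - (f z - D x z)) with
    ((f w - f z - D z (vsub w z)) + (D z (vsub w z) - D x (vsub w z))) by (rewrite E; ring).
  eapply Rle_trans; [apply Rabs_triang|]. lra.
Qed.

Lemma C1_of_smooth f : (forall x, S x -> smooth S f x) -> C1_on S f.
Proof.
  intros H.
  set (D := fun x => epsilon (inhabits (fun _ => 0)) (sdiff S f x)).
  assert (HD : forall x, S x -> sdiff S f x (D x)).
  { intros x Sx. apply epsilon_spec. now apply H. }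
  exists D. split.
  - intros y Sy. destruct (HD y Sy) as [HL Hy]. split; [assumption|]. intros eps Heps.
    destruct (Hy eps Heps) as [r [Hr Hl]]. exists r. split; [assumption|]. intros h Sh Hh.
    assert (Syh : S (vadd X y h)) by (apply HS; assumption).
    specialize (Hl _ y Syh Sy ltac:(rewrite dist_addl; lra) ltac:(rewrite dist_xx; lra)).
    rewrite dist_addl in Hl. destruct HL as [Ha _]. rewrite Ha in Hl by assumption.
    eapply Rle_trans; [|exact Hl]. right. f_equal. ring.
  - intros y Sy eps Heps. destruct (HD y Sy) as [[Ya [Ys _]] Hy].
    destruct (Hy (eps / 2) ltac:(lra)) as [r [Hr Hl]].
    exists (r / 2). split; [lra|]. intros z Sz Hz h Sh.
    destruct (HD z Sz) as [[Za [Zs _]] Hz'].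
    destruct (Hz' (eps / 2) ltac:(lra)) as [s [Hs Hm]].
    pose proof (vnorm_ge0 h) as Hh.
    (* A multiple of [h] short enough for both the ball around [y], where [D y] approximates, and
       the ball around [z], whose radius is not controlled. One increment of [f] then compares [D y]
       with [D z], and homogeneity removes [t]. *)
    set (t := Rmin (r / 2) s / (vnorm X h + 1)).
    assert (Hmin : 0 < Rmin (r / 2) s) by (apply Rmin_glb_lt; lra).
    assert (Ht : 0 < t) by (apply Rdiv_lt_0_compat; lra).
    assert (Hth : t * vnorm X h < Rmin (r / 2) s).
    { replace (Rmin (r / 2) s) with (t * (vnorm X h + 1)) by (unfold t; field; lra). nra. }
    pose proof (Rmin_l (r / 2) s). pose proof (Rmin_r (r / 2) s).
    assert (Sth : S (vscal X t h)) by (apply HS; assumption).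
    assert (Nth : vnorm X (vscal X t h) = t * vnorm X h).
    { now rewrite vnorm_scal, Rabs_pos_eq by lra. }
    assert (Szh : S (vadd X z (vscal X t h))) by (apply HS; assumption).
    fold (dist z y) in Hz.
    assert (dist (vadd X z (vscal X t h)) y < r).
    { pose proof (dist_tri (vadd X z (vscal X t h)) z y) as T.
      rewrite dist_addl, Nth in T. lra. }
    specialize (Hl _ z Szh Sz ltac:(lra) ltac:(lra)).
    specialize (Hm _ z Szh Sz ltac:(rewrite dist_addl, Nth; lra) ltac:(rewrite dist_xx; lra)).
    rewrite dist_addl, Nth in Hl, Hm. rewrite Ya, Ys in Hl by assumption.
    rewrite Za, Zs in Hm by assumption.
    apply Rmult_le_reg_l with t; [assumption|].
    rewrite <- (Rabs_pos_eq t) at 1 by lra. rewrite <- Rabs_mult.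
    set (fz := f (vadd X z (vscal X t h))) in *.
    replace (t * (D z h - D y h)) with
      ((fz - (D y z + t * D y h) - (f z - D y z)) - (fz - (D z z + t * D z h) - (f z - D z z)))
      by ring.
    unfold Rminus at 1. eapply Rle_trans; [apply Rabs_triang|]. rewrite Rabs_Ropp. lra.
Qed.

End Frechet.

(** * Infima, Lipschitz and linear extensions *)

Lemma fun_choice (A B : Type) (P : A -> B -> Prop) :
  (forall x, exists y, P x y) -> exists f, forall x, P x (f x).
Proof.
  intros H. exists (fun x => proj1_sig (constructive_indefinite_description _ (H x))).
  intros x. apply proj2_sig.
Qed.

Lemma exists_inf (I T : Type) (P : I -> Prop) (F : I -> T -> R) :
  (exists i, P i) -> (forall x, exists m, forall i, P i -> m <= F i x) ->
  exists g : T -> R, forall x, (forall i, P i -> g x <= F i x) /\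
    (forall c, (forall i, P i -> c <= F i x) -> c <= g x).
Proof.
  intros [i0 Hi0] Hb.
  assert (H : forall x, exists l, (forall i, P i -> l <= F i x) /\
    (forall c, (forall i, P i -> c <= F i x) -> c <= l)).
  { intros x. destruct (Hb x) as [m Hm].
    destruct (completeness (fun t => exists i, P i /\ t = - F i x)) as [l [Hub Hlub]].
    - exists (- m). intros t [i [Hi ->]]. specialize (Hm i Hi). lra.
    - now exists (- F i0 x), i0.
    - exists (- l). split.
      + intros i Hi. assert (- F i x <= l) by (apply Hub; now exists i). lra.
      + intros c Hc. assert (l <= - c); [|lra].
        apply Hlub. intros t [i [Hi ->]]. specialize (Hc i Hi). lra. }
  exact (fun_choice H).
Qed.

Section Extension.
Variable X : Banach.
Implicit Types x y z u v h : X.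

(** McShane's formula: the infimum over [p] in [P] of [g p + M * dist x p]. *)
Lemma lip_extension (P : X -> Prop) (g : X -> R) (M : R) : 0 <= M -> (exists p, P p) ->
  (forall u v, P u -> P v -> Rabs (g u - g v) <= M * dist u v) ->
  exists F : X -> R, (forall u v, Rabs (F u - F v) <= M * dist u v) /\
    (forall u, P u -> F u = g u).
Proof.
  intros HM HP Hg.
  destruct (@exists_inf X X P (fun p x => g p + M * dist x p) HP) as [F HF].
  { intros x. destruct HP as [p0 Hp0]. exists (g p0 - M * dist x p0). intros p Hp.
    specialize (Hg p0 p Hp0 Hp). pose proof (Rle_abs (g p0 - g p)).
    pose proof (dist_tri p0 x p) as T. rewrite (dist_sym p0 x) in T. nra. }
  assert (step : forall u v, F u - M * dist u v <= F v).
  { intros u v. apply HF. intros p Hp. destruct (HF u) as [H _]. specialize (H p Hp).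
    pose proof (dist_tri u v p). nra. }
  exists F. split.
  - intros u v. pose proof (step u v). pose proof (step v u) as H'.
    rewrite (dist_sym v u) in H'. apply Rabs_le. lra.
  - intros u Hu. apply Rle_antisym.
    + destruct (HF u) as [H _]. specialize (H u Hu). rewrite dist_xx in H. lra.
    + apply HF. intros p Hp. specialize (Hg u p Hu Hp).
      pose proof (Rle_abs (g u - g p)). lra.
Qed.

(** * Minimal sublinear functionals and the Hahn-Banach theorem *)

Definition sublinear (q : X -> R) : Prop :=
  (forall x y, q (vadd X x y) <= q x + q y) /\
  (forall t x, 0 < t -> q (vscal X t x) <= t * q x).

Lemma sublinear_0 q : sublinear q -> q (vzero X) = 0.
Proof.
  intros [_ H]. pose proof (H 2 (vzero X) ltac:(lra)) as H1.
  pose proof (H (/ 2) (vzero X) ltac:(lra)) as H2. rewrite vscal_zero in *. lra.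
Qed.

(** The one-sided inequality, which is easy to check for infima, yields equality when applied to the
    scalar [/ t]. *)
Lemma sublinear_homog q t x : sublinear q -> 0 <= t -> q (vscal X t x) = t * q x.
Proof.
  intros Hq [Ht|<-].
  - apply Rle_antisym; [now apply Hq|].
    pose proof (proj2 Hq (/ t) (vscal X t x) (Rinv_0_lt_compat _ Ht)) as H.
    replace (vscal X (/ t) (vscal X t x)) with x in H by vec.
    apply Rmult_le_compat_l with (r := t) in H; [|lra].
    rewrite <- Rmult_assoc, Rinv_r, Rmult_1_l in H by lra. exact H.
  - rewrite vscal_0, sublinear_0 by assumption. ring.
Qed.

Lemma sublinear_ge q x : sublinear q -> - q (vopp X x) <= q x.
Proof.
  intros Hq. pose proof (proj1 Hq x (vopp X x)) as H.
  rewrite vadd_opp, sublinear_0 in H by assumption. lra.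
Qed.

(** The infimum over [t >= 0] of [q (z + t a) - t * q a] is again sublinear and below [q], so
    minimality puts [q] below it; the term [t = 1] gives the missing inequality. *)
Lemma minimal_sublinear_additive q : sublinear q ->
  (forall q', sublinear q' -> (forall x, q' x <= q x) -> forall x, q x <= q' x) ->
  forall x a, q (vadd X x a) = q x + q a.
Proof.
  intros Hq Hmin x a.
  destruct (@exists_inf R X (fun t => 0 <= t)
    (fun t z => q (vadd X z (vscal X t a)) - t * q a)) as [g Hg].
  { exists 0. lra. }
  { intros z. exists (- q (vopp X z)). intros t Ht.
    pose proof (proj1 Hq (vadd X z (vscal X t a)) (vopp X z)) as H.
    replace (vadd X (vadd X z (vscal X t a)) (vopp X z)) with (vscal X t a) in H by vec.
    rewrite sublinear_homog in H by assumption. lra. }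
  apply Rle_antisym; [apply Hq|].
  assert (Hle : q x <= g x).
  { apply Hmin.
    - split.
      + intros y z. assert (g (vadd X y z) - g z <= g y); [|lra].
        apply Hg. intros s Hs. assert (g (vadd X y z) - (q (vadd X y (vscal X s a)) - s * q a) <= g z); [|lra].
        apply Hg. intros t Ht. destruct (Hg (vadd X y z)) as [H _].
        specialize (H (s + t) ltac:(lra)).
        pose proof (proj1 Hq (vadd X y (vscal X s a)) (vadd X z (vscal X t a))) as H'.
        replace (vadd X (vadd X y (vscal X s a)) (vadd X z (vscal X t a)))
          with (vadd X (vadd X y z) (vscal X (s + t) a)) in H' by vec. lra.
      + intros c y Hc. assert (g (vscal X c y) / c <= g y) as H.
        * apply Hg. intros t Ht. destruct (Hg (vscal X c y)) as [H _].
          specialize (H (c * t) ltac:(nra)).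
          replace (vadd X (vscal X c y) (vscal X (c * t) a))
            with (vscal X c (vadd X y (vscal X t a))) in H by vec.
          rewrite (@sublinear_homog q) in H by (assumption || lra).
          apply Rmult_le_reg_l with c; [assumption|].
          replace (c * (g (vscal X c y) / c)) with (g (vscal X c y)) by (field; lra). lra.
        * apply Rmult_le_compat_l with (r := c) in H; [|lra].
          replace (c * (g (vscal X c y) / c)) with (g (vscal X c y)) in H by (field; lra).
          exact H.
    - intros z. destruct (Hg z) as [H _]. specialize (H 0 ltac:(lra)).
      replace (vadd X z (vscal X 0 a)) with z in H by vec. lra. }
  destruct (Hg x) as [H _]. specialize (H 1 ltac:(lra)).
  replace (vadd X x (vscal X 1 a)) with (vadd X x a) in H by vec. lra.
Qed.

(** Zorn's lemma for the reversed pointwise order. The infimum of a chain is finite because each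
    member [q] satisfies [q x >= - q (- x) >= - p (- x)]. *)
Lemma exists_minimal_sublinear p : sublinear p -> exists q, sublinear q /\
  (forall x, q x <= p x) /\
  (forall q', sublinear q' -> (forall x, q' x <= q x) -> forall x, q x <= q' x).
Proof.
  intros Hp. set (T := {q : X -> R | sublinear q /\ forall x, q x <= p x}).
  set (le := fun q1 q2 : T => boolp.asbool (forall x, proj1_sig q2 x <= proj1_sig q1 x)).
  assert (leP : forall q1 q2, is_true (le q1 q2) <-> (forall x, proj1_sig q2 x <= proj1_sig q1 x)).
  { intros q1 q2. unfold le. split; intros H.
    - exact (boolp.asboolW H).
    - exact (boolp.asboolT H). }
  set (p0 := exist (fun q => sublinear q /\ forall x, q x <= p x) p (conj Hp (fun x => Rle_refl _)) : T).
  destruct (@classical_sets.ZL_preorder T p0 le) as [[q [Hq Hqp]] Hmax].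
  - intros q. apply leP. intros; lra.
  - intros q1 q2 q3 H12 H23. apply leP. intros x.
    pose proof (proj1 (leP _ _) H12 x). pose proof (proj1 (leP _ _) H23 x). lra.
  - intros A HA. destruct (classic (exists q, A q)) as [HAne|HAe].
    + destruct (@exists_inf T X A (fun q x => proj1_sig q x) HAne) as [g Hg].
      { intros x. exists (- p (vopp X x)). intros [q [Hq Hqp]] _. simpl.
        pose proof (sublinear_ge x Hq). specialize (Hqp (vopp X x)). lra. }
      assert (Hgs : sublinear g).
      { split.
        - intros x y. assert (g (vadd X x y) - g y <= g x); [|lra].
          apply Hg. intros q1 H1. assert (g (vadd X x y) - proj1_sig q1 x <= g y); [|lra].
          apply Hg. intros q2 H2. destruct (Hg (vadd X x y)) as [H _].
          (* Subadditivity of the infimum needs one member below both [q1] and [q2]; comparability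
             in the chain provides it. *)
          destruct (HA q1 q2 H1 H2) as [H12|H12]; pose proof (proj1 (leP _ _) H12) as L.
          + specialize (H q2 H2). specialize (L x).
            pose proof (proj1 (proj1 (proj2_sig q2)) x y). lra.
          + specialize (H q1 H1). specialize (L y).
            pose proof (proj1 (proj1 (proj2_sig q1)) x y). lra.
        - intros c x Hc. assert (g (vscal X c x) / c <= g x) as H.
          + apply Hg. intros q Hq. destruct (Hg (vscal X c x)) as [H _].
            specialize (H q Hq). pose proof (proj2 (proj1 (proj2_sig q)) c x Hc) as H'.
            apply Rmult_le_reg_l with c; [assumption|].
            replace (c * (g (vscal X c x) / c)) with (g (vscal X c x)) by (field; lra). lra.
          + apply Rmult_le_compat_l with (r := c) in H; [|lra].
            replace (c * (g (vscal X c x) / c)) with (g (vscal X c x)) in H by (field; lra).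
            exact H. }
      assert (Hgp : forall x, g x <= p x).
      { intros x. destruct HAne as [q Hq]. destruct (Hg x) as [H _]. specialize (H q Hq).
        pose proof (proj2 (proj2_sig q) x). simpl in *. lra. }
      exists (exist _ g (conj Hgs Hgp)). intros q Hq. apply leP. intros x. simpl.
      now apply Hg.
    + exists p0. intros q Hq. exfalso. apply HAe. now exists q.
  - exists q. split; [assumption|]. split; [assumption|]. intros q' Hq' Hle x.
    assert (Hq'p : forall x, q' x <= p x).
    { intros y. pose proof (Hle y). pose proof (Hqp y). lra. }
    specialize (Hmax (exist _ q' (conj Hq' Hq'p))).
    rewrite !leP in Hmax. simpl in Hmax. now apply Hmax.
Qed.

(* Hahn-Banach: a minimal sublinear functional below the McShane extension
   [inf_y (D y + M |x - y|)] is linear and, being below [D] on [Y], agrees with it there. *)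
Lemma linear_extension (Y : X -> Prop) (D : X -> R) (M : R) : subspace Y -> 0 <= M ->
  bounded_linear_on Y D -> (forall h, Y h -> Rabs (D h) <= M * vnorm X h) ->
  exists l, bounded_linear_on (whole X) l /\ (forall h, Rabs (l h) <= M * vnorm X h) /\
    (forall h, Y h -> l h = D h).
Proof.
  intros HY HM HD HDM. pose proof HD as [Da [Ds _]]. pose proof HY as [Y0 [Ya Ys]].
  assert (D0 : D (vzero X) = 0).
  { rewrite <- (vscal_0 (vzero X)), Ds by assumption. ring. }
  destruct (@exists_inf X X Y (fun y x => D y + M * dist x y)) as [p Hp].
  { now exists (vzero X). }
  { intros x. exists (- (M * vnorm X x)). intros y Hy. specialize (HDM y Hy).
    pose proof (Rle_abs (- D y)) as A. rewrite Rabs_Ropp in A.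
    pose proof (dist_tri y x (vzero X)) as T. rewrite !dist_0, (dist_sym y x) in T. nra. }
  assert (Hpn : forall x, p x <= M * vnorm X x).
  { intros x. destruct (Hp x) as [H _]. specialize (H _ Y0). rewrite dist_0, D0 in H. lra. }
  assert (HpY : forall y, Y y -> p y <= D y).
  { intros y Hy. destruct (Hp y) as [H _]. specialize (H _ Hy). rewrite dist_xx in H. lra. }
  assert (Hps : sublinear p).
  { split.
    - intros x z. assert (p (vadd X x z) - p z <= p x); [|lra].
      apply Hp. intros y Hy. assert (p (vadd X x z) - (D y + M * dist x y) <= p z); [|lra].
      apply Hp. intros w Hw. destruct (Hp (vadd X x z)) as [H _].
      specialize (H _ (Ya _ _ Hy Hw)). rewrite Da in H by assumption.
      assert (dist (vadd X x z) (vadd X y w) <= dist x y + dist z w); [|nra].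
      unfold dist. eapply Rle_trans; [|apply vnorm_triangle]. right. f_equal. vec.
    - intros c x Hc. assert (p (vscal X c x) / c <= p x) as H.
      + apply Hp. intros y Hy. destruct (Hp (vscal X c x)) as [H _].
        specialize (H _ (Ys c _ Hy)). rewrite Ds in H by assumption.
        assert (E : dist (vscal X c x) (vscal X c y) = c * dist x y).
        { unfold dist. rewrite <- (Rabs_pos_eq c) at 3 by lra. rewrite <- vnorm_scal.
          f_equal. vec. }
        rewrite E in H. apply Rmult_le_reg_l with c; [assumption|].
        replace (c * (p (vscal X c x) / c)) with (p (vscal X c x)) by (field; lra). lra.
      + apply Rmult_le_compat_l with (r := c) in H; [|lra].
        replace (c * (p (vscal X c x) / c)) with (p (vscal X c x)) in H by (field; lra).
        exact H. }
  destruct (exists_minimal_sublinear Hps) as [l [Hl [Hlp Hmin]]].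
  assert (la : forall x y, l (vadd X x y) = l x + l y).
  { now apply minimal_sublinear_additive. }
  assert (lo : forall x, l (vopp X x) = - l x).
  { intros x. pose proof (la x (vopp X x)) as H. rewrite vadd_opp, sublinear_0 in H by assumption.
    lra. }
  assert (ln : forall h, Rabs (l h) <= M * vnorm X h).
  { intros h. apply Rabs_le. split.
    - pose proof (Hlp (vopp X h)). pose proof (Hpn (vopp X h)) as H'.
      rewrite vnorm_opp in H'. rewrite lo in *. lra.
    - eapply Rle_trans; [apply Hlp | apply Hpn]. }
  exists l. split; [|split; [assumption|]].
  - split; [auto|]. split; [|exists M; auto]. intros a h _.
    destruct (Rle_lt_dec 0 a) as [Ha|Ha]; [now apply sublinear_homog|].
    replace (vscal X a h) with (vopp X (vscal X (- a) h)) by vec.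
    rewrite lo, sublinear_homog by (assumption || lra). ring.
  - intros h Hh. apply Rle_antisym.
    + eapply Rle_trans; [apply Hlp | now apply HpY].
    + assert (H : l (vopp X h) <= - D h).
      { eapply Rle_trans; [apply Hlp|]. rewrite vopp_scal.
        eapply Rle_trans; [apply HpY; auto|]. rewrite Ds by assumption. lra. }
      rewrite lo in H. lra.
Qed.

End Extension.

(** * Discrete decompositions and cutoffs *)

Lemma exists_well_order (T : Type) : exists le : T -> T -> Prop,
  (forall x y, le x y -> le y x -> x = y) /\
    (forall P : T -> Prop, (exists x, P x) -> exists m, P m /\ forall y, P y -> le m y).
Proof.
  (* [boolp.Peq] equips [T] with a decidable equality. *)
  assert (W : exists le : ssrbool.rel T, wochoice.well_order le).
  { revert T. refine (boolp.Peq _). intros T.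
    destruct (wochoice.well_ordering_principle T) as [le Hle]. now exists le. }
  destruct W as [le Hle].
  exists (fun x y => is_true (le x y)). split.
  (* The well-order only provides unique minima of nonempty sets. Reflexivity comes from singletons;
     then [x] and [y] are both minima of the pair they form, hence equal. *)
  - intros x y Hxy Hyx.
    set (A := fun z : T => boolp.asbool (z = x \/ z = y)).
    assert (Hrefl : forall z : T, is_true (le z z)).
    { intros z. destruct (Hle (fun t : T => boolp.asbool (t = z))) as [m [[Hm Hlow] _]].
      - exists z. apply boolp.asboolT. reflexivity.
      - apply boolp.asboolW in Hm. subst m. apply Hlow, boolp.asboolT. reflexivity. }
    destruct (Hle A) as [m [_ Huniq]].
    + exists x. apply boolp.asboolT. now left.
    + rewrite <- (Huniq x), <- (Huniq y); [reflexivity| |]; split.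
      * apply boolp.asboolT. now right.
      * intros z Hz. apply boolp.asboolW in Hz. now destruct Hz as [->| ->].
      * apply boolp.asboolT. now left.
      * intros z Hz. apply boolp.asboolW in Hz. now destruct Hz as [->| ->].
  - intros P [x Hx]. destruct (Hle (fun z : T => boolp.asbool (P z))) as [m [[Hm Hlow] _]].
    + exists x. now apply boolp.asboolT.
    + exists m. split; [now apply boolp.asboolW in Hm|].
      intros y Hy. apply Hlow. now apply boolp.asboolT.
Qed.

Section Cutoffs.
Variable X : Banach.

(* Stone's trick: [alpha v] is the least centre whose ball contains [v]. Points lying deep
   in the ball of their centre and having different centres are far apart. *)
Lemma discrete_centres (S : X -> Prop) (r : X -> R) : (forall x, S x -> 0 < r x) ->
  exists alpha : X -> X,
    (forall v, S v -> S (alpha v) /\ dist v (alpha v) < r (alpha v)) /\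
    (forall v w, S v -> S w -> dist v w < r (alpha v) - dist v (alpha v) ->
       dist v w < r (alpha w) - dist w (alpha w) -> alpha v = alpha w).
Proof.
  intros Hr. destruct (exists_well_order X) as [le [Hanti Hmin]].
  assert (H : forall v, exists a, S v -> (S a /\ dist v a < r a) /\
    forall b, S b /\ dist v b < r b -> le a b).
  { intros v. destruct (classic (S v)) as [Sv|Sv]; [|now exists v].
    destruct (Hmin (fun a => S a /\ dist v a < r a)) as [a Ha].
    - exists v. rewrite dist_xx. auto.
    - now exists a. }
  destruct (fun_choice H) as [alpha Halpha]. exists alpha. split.
  - intros v Sv. now apply Halpha.
  - intros v w Sv Sw Hva Hwb. destruct (Halpha v Sv) as [[Sa da] mina].
    destruct (Halpha w Sw) as [[Sb db] minb].
    apply Hanti.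
    + apply mina. split; [assumption|]. pose proof (dist_tri v w (alpha w)). lra.
    + apply minb. split; [assumption|]. pose proof (dist_tri w v (alpha v)) as T.
      rewrite (dist_sym w v) in T. lra.
Qed.

(** [property_star] in terms of strict differentiability; [1 <= C0] allows a constant [L] to be
    absorbed into [C0 * L]. *)
Definition smooth_approx (C0 : R) : Prop :=
  1 <= C0 /\ forall (f : X -> R) (L : R), 0 <= L ->
    (forall u v, Rabs (f u - f v) <= L * dist u v) ->
    forall eps, 0 < eps -> exists K : X -> R, (forall x, smooth (whole X) K x) /\
      (forall u v, Rabs (K u - K v) <= C0 * L * dist u v) /\
      (forall x, Rabs (f x - K x) < eps).

Lemma smooth_approx_of_star : property_star X -> exists C0, smooth_approx C0.
Proof.
  intros [C0 H]. exists (Rmax 1 C0). split; [apply Rmax_l|]. intros f L HL Hf eps Heps.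
  destruct (H f L (conj HL (fun x y _ _ => Hf x y)) eps Heps) as [K [HK [[_ HLK] Happ]]].
  exists K. split; [|split; [|assumption]].
  - intros x. apply smooth_of_C1; [apply whole_subspace | assumption | exact I].
  - intros u v. eapply Rle_trans; [now apply HLK|].
    apply Rmult_le_compat_r; [apply dist_ge0|].
    apply Rmult_le_compat_r; [assumption | apply Rmax_r].
Qed.

Lemma posq_lip s t : s <= 1 -> t <= 1 -> Rabs (posq s - posq t) <= 2 * Rabs (s - t).
Proof.
  intros Hs Ht. unfold posq, Rmax, Rabs.
  repeat destruct Rle_dec; repeat destruct Rcase_abs; nra.
Qed.

(** A C^1 descent from 1 to 0 on [[0, 1]]: the inner [posq] flattens it at 0, the outer one at 1. *)
Definition step (t : R) : R := posq (1 - posq t).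

Lemma posq_bounds t : 0 <= posq t /\ (t <= 1 -> posq t <= 1).
Proof. unfold posq, Rmax. destruct Rle_dec; split; intros; nra. Qed.

Lemma step_bounds t : 0 <= step t <= 1.
Proof.
  pose proof (posq_bounds t). pose proof (posq_bounds (1 - posq t)) as [H1 H2].
  unfold step. split; [assumption|]. apply H2. lra.
Qed.

Lemma step_le0 t : t <= 0 -> step t = 1.
Proof.
  intros H. unfold step. assert (E : posq t = 0).
  { unfold posq, Rmax. destruct Rle_dec; nra. }
  rewrite E. unfold posq, Rmax. destruct Rle_dec; lra.
Qed.

Lemma step_ge1 t : 1 <= t -> step t = 0.
Proof.
  intros H. unfold step. assert (E : 1 <= posq t).
  { unfold posq, Rmax. destruct Rle_dec; nra. }
  unfold posq at 1, Rmax. destruct Rle_dec; nra.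
Qed.

(** [posq] is 2-Lipschitz only near and below 1, whence the factor 4 for arguments at most 1; beyond
    1 the step is constant. *)
Lemma step_lip s t : Rabs (step s - step t) <= 4 * Rabs (s - t).
Proof.
  assert (A : forall s t, s <= 1 -> t <= 1 -> Rabs (step s - step t) <= 4 * Rabs (s - t)).
  { clear. intros s t Hs Ht. unfold step. pose proof (posq_bounds s). pose proof (posq_bounds t).
    eapply Rle_trans; [apply posq_lip; lra|].
    replace (1 - posq s - (1 - posq t)) with (posq t - posq s) by ring.
    rewrite Rabs_minus_sym. pose proof (posq_lip Hs Ht). lra. }
  assert (B : forall s t, s <= 1 -> 1 <= t -> Rabs (step s - step t) <= 4 * Rabs (s - t)).
  { clear - A. intros s t Hs Ht. rewrite (step_ge1 Ht), <- (step_ge1 (Rle_refl 1)).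
    eapply Rle_trans; [apply A; lra|]. unfold Rabs. repeat destruct Rcase_abs; lra. }
  destruct (Rle_lt_dec s 1), (Rle_lt_dec t 1); auto.
  - apply B; lra.
  - rewrite Rabs_minus_sym, (Rabs_minus_sym s). apply B; lra.
  - rewrite !step_ge1 by lra. rewrite Rminus_diag, Rabs_R0. pose proof (Rabs_pos (s - t)). lra.
Qed.

Lemma cutoff C0 (V : X -> Prop) (w : R) : smooth_approx C0 -> 0 < w ->
  exists a : X -> R, (forall x, smooth (whole X) a x) /\
    (forall u v, Rabs (a u - a v) <= 16 * C0 / w * dist u v) /\
    (forall x, 0 <= a x <= 1) /\
    (forall x v, V v -> dist x v < w / 2 -> a x = 1) /\
    (forall x, (forall v, V v -> w <= dist x v) -> a x = 0).
Proof.
  intros [HC0 Happ] Hw. destruct (classic (exists v, V v)) as [Vne|Vempty].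
  2: { exists (fun _ => 0). repeat split; try lra.
    - intros x. apply smooth_const.
    - intros u v. rewrite Rminus_diag, Rabs_R0. apply Rmult_le_pos; [|apply dist_ge0].
      apply Rmult_le_pos; [lra|]. apply Rlt_le, Rinv_0_lt_compat, Hw.
    - intros x v Hv. exfalso. apply Vempty. now exists v. }
  destruct (@exists_inf X X V (fun v x => dist x v) Vne) as [d Hd].
  { intros x. exists 0. intros v _. apply dist_ge0. }
  assert (dlip : forall u v, Rabs (d u - d v) <= 1 * dist u v).
  { assert (A : forall u v, d u - dist u v <= d v).
    { intros u v. apply Hd. intros z Hz. destruct (Hd u) as [H _]. specialize (H z Hz).
      pose proof (dist_tri u v z). lra. }
    intros u v. pose proof (A u v). pose proof (A v u) as A'. rewrite (dist_sym v u) in A'.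
    apply Rabs_le. lra. }
  (* With accuracy [w / 8], [K] is below [5 * w / 8] where [d] is below [w / 2], and above
     [7 * w / 8] where [d] is at least [w]. [t] rescales this gap of [w / 4] to [[0, 1]], and the
     slope becomes [4 * (4 / w) * C0]. *)
  destruct (Happ d 1 Rle_0_1 dlip (w / 8) ltac:(lra)) as [K [HK [Klip Kd]]].
  set (t := fun x => (4 / w) * (K x + - (5 * w / 8))).
  exists (fun x => step (t x)). repeat split; try apply step_bounds.
  - intros x. unfold step.
    apply smooth_posq with (f := fun x => 1 - posq (t x)); [apply whole_subspace|exact I|].
    apply smooth_sub; [apply smooth_const|].
    apply smooth_posq; [apply whole_subspace|exact I|].
    apply smooth_scal. apply smooth_add; [apply HK | apply smooth_const].
  - intros u v. eapply Rle_trans; [apply step_lip|]. unfold t.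
    rewrite <- Rmult_minus_distr_l, Rabs_mult, Rabs_pos_eq.
    2: { apply Rlt_le, Rdiv_lt_0_compat; lra. }
    replace (K u + - (5 * w / 8) - (K v + - (5 * w / 8))) with (K u - K v) by ring.
    apply Rle_trans with (4 * (4 / w * (C0 * 1 * dist u v))).
    + apply Rmult_le_compat_l; [lra|].
      apply Rmult_le_compat_l; [apply Rlt_le, Rdiv_lt_0_compat; lra | apply Klip].
    + right. field. lra.
  - intros x v Hv Hx. apply step_le0. unfold t.
    destruct (Hd x) as [H _]. specialize (H v Hv). specialize (Kd x).
    apply Rabs_def2 in Kd. assert (0 < 4 / w) by (apply Rdiv_lt_0_compat; lra). nra.
  - intros x Hx. apply step_ge1. unfold t. destruct (Hd x) as [_ H]. specialize (H w Hx).
    specialize (Kd x). apply Rabs_def2 in Kd.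
    replace 1 with (4 / w * (w / 4)) by (field; lra).
    apply Rmult_le_compat_l; [apply Rlt_le, Rdiv_lt_0_compat; lra|]. lra.
Qed.

End Cutoffs.

(** * Gluing local approximations *)

Definition scale (n : nat) : R := (/ 2) ^ n.
Definition thickness (n : nat) : R := scale n * scale n / 2.

Lemma scale_pos n : 0 < scale n.
Proof. apply pow_lt. lra. Qed.

Lemma scale_S n : scale (S n) = scale n / 2.
Proof. unfold scale. simpl. field. Qed.

Lemma scale_le1 n : scale n <= 1.
Proof. induction n; [unfold scale; simpl; lra|]. rewrite scale_S. pose proof (scale_pos n). lra. Qed.

Lemma scale_small e : 0 < e -> exists n, scale n < e.
Proof.
  intros He. destruct (pow_lt_1_zero (/ 2)) with (y := e) as [N HN]; [|assumption|].
  - rewrite Rabs_pos_eq; lra.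
  - exists N. specialize (HN N (le_n N)). apply Rabs_def2 in HN. apply HN.
Qed.

Lemma thickness_pos n : 0 < thickness n.
Proof. pose proof (scale_pos n). unfold thickness. nra. Qed.

Lemma thickness_S n : thickness (S n) = thickness n / 4.
Proof. unfold thickness. rewrite scale_S. field. Qed.

Lemma thickness_le n : 2 * thickness n <= scale n.
Proof. pose proof (scale_pos n). pose proof (scale_le1 n). unfold thickness. nra. Qed.

(** * Separated levels of local pieces *)

Section Levels.
Variable X : Banach.
Variables (C0 : R) (Y : X -> Prop) (r : X -> R) (s : nat -> X -> X -> R).
Hypothesis HC0 : smooth_approx X C0.
Hypothesis Hr : forall y, Y y -> 0 < r y.

Lemma exists_levels : exists a T : nat -> X -> R,
  (forall n x, smooth (whole X) (a n) x) /\
  (forall n u v, Rabs (a n u - a n v) <= 16 * C0 / scale n * dist u v) /\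
  (forall n x, 0 <= a n x <= 1) /\
  (forall n x, near x (fun u => a n u = 0) \/
     exists y, Y y /\ near x (fun u => T n u = s n y u /\ dist u y < r y - scale n)) /\
  (forall x, Y x -> exists n, near x (fun u => a n u = 1)).
Proof.
  destruct (discrete_centres Hr) as [alpha [Halpha Hdisc]].
  (* Level [n] keeps the points whose ball of radius [3 * scale n] fits inside the ball of their
     centre. Two such points closer than [3 * scale n] share their centre, so all candidates within
     [3 / 2 * scale n] of a given point agree. *)
  set (V := fun n v => Y v /\ 3 * scale n < r (alpha v) - dist v (alpha v)).
  destruct (fun_choice (fun n => cutoff (V n) HC0 (scale_pos n))) as [a Ha].
  (* The value does not depend on the candidate chosen; where there is none, it is arbitrary, but
     there [a n] vanishes. *)
  set (T := fun n x => s n (alpha (epsilon (inhabits (vzero X))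
              (fun v => V n v /\ dist x v < 3 / 2 * scale n))) x).
  exists a, T. split; [intros n; apply Ha|]. split; [intros n; apply Ha|].
  split; [intros n; apply Ha|]. split.
  - intros n x. pose proof (scale_pos n).
    destruct (classic (exists v, V n v /\ dist x v < 3 / 2 * scale n)) as [[v [Hv Hxv]]|Hno].
    + right. exists (alpha v). destruct Hv as [Yv Hv]. split; [now apply Halpha|].
      eapply near_imp; [|exact (near_dist_lt Hxv)]. intros u Hu. simpl in Hu. split.
      * unfold T. set (v' := epsilon _ _).
        assert (Hv' : V n v' /\ dist u v' < 3 / 2 * scale n).
        { unfold v'. apply epsilon_spec. exists v. now repeat split. }
        destruct Hv' as [[Yv' Hv'] Huv'].
        pose proof (dist_tri v u v') as D. rewrite (dist_sym v u) in D.
        apply (f_equal (fun z => s n z u)). symmetry. apply Hdisc; auto; lra.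
      * pose proof (dist_tri u v (alpha v)). lra.
    + left. eapply near_imp; [|apply (@near_dist_ge X x (V n) (3 / 2 * scale n) (scale n)); [lra|]].
      * intros u Hu. now apply Ha.
      * intros v Hv. apply Rnot_lt_le. intros Hlt. apply Hno. now exists v.
  (* A point of [Y] lies strictly inside the ball of its centre, so it belongs to [V n] as soon as
     [scale n] is small enough. *)
  - intros x Yx. destruct (Halpha x Yx) as [_ Hx].
    destruct (@scale_small ((r (alpha x) - dist x (alpha x)) / 3)) as [n Hn]; [lra|].
    exists n. eapply near_imp; [|apply (@near_ball X x (scale n / 2)); pose proof (scale_pos n); lra].
    intros u Hu. simpl in Hu. destruct (Ha n) as [_ [_ [_ [H1 _]]]]. apply (H1 u x); [|assumption].
    split; [assumption|lra].
Qed.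

End Levels.

(** * The glued function and its error on the subspace *)

Section Gluing.
Variable X : Banach.
Variables (C0 eps : R) (Y : X -> Prop) (f : X -> R) (r : X -> R) (s : nat -> X -> X -> R).
Variables a T theta G : nat -> X -> R.
Hypothesis HC0 : 1 <= C0.
Hypothesis Heps : 0 < eps.
Hypothesis HY : subspace Y.
Hypothesis Yclosed : forall x, ~ Y x -> exists e, 0 < e /\ forall y, Y y -> e <= dist x y.

(** Chosen so that switching by [a n] between two functions within [tol n] of [f] costs
    [eps / 2 * scale (S n)] ([a_cost]); over all levels this sums to [eps / 2]. *)
Definition tol (n : nat) : R := eps * thickness n / (64 * C0).

Hypothesis s_smooth : forall n y x, Y y -> smooth (whole X) (s n y) x.
Hypothesis s_lip : forall n y u v, Y y -> Y u -> Y v -> dist u y < r y -> dist v y < r y ->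
  Rabs ((s n y u - f u) - (s n y v - f v)) <= eps / 2 * dist u v.
Hypothesis s_val : forall n y u, Y y -> Y u -> dist u y < r y -> Rabs (s n y u - f u) <= tol n.

Hypothesis a_smooth : forall n x, smooth (whole X) (a n) x.
Hypothesis a_lip : forall n u v, Rabs (a n u - a n v) <= 16 * C0 / scale n * dist u v.
Hypothesis a_01 : forall n x, 0 <= a n x <= 1.
Hypothesis T_local : forall n x, near x (fun u => a n u = 0) \/
  exists y, Y y /\ near x (fun u => T n u = s n y u /\ dist u y < r y - scale n).
Hypothesis a_exhaust : forall x, Y x -> exists n, near x (fun u => a n u = 1).

Hypothesis th_smooth : forall n x, smooth (whole X) (theta n) x.
Hypothesis th_lip : forall n u v, Rabs (theta n u - theta n v) <= 16 * C0 / thickness n * dist u v.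
Hypothesis th_01 : forall n x, 0 <= theta n x <= 1.
Hypothesis th_1 : forall n x y, Y y -> dist x y < thickness n / 2 -> theta n x = 1.
Hypothesis th_0 : forall n x, (forall y, Y y -> thickness n <= dist x y) -> theta n x = 0.

Hypothesis G_smooth : forall n x, smooth (whole X) (G n) x.

(* [glue k n] uses the levels [n, ..., n + k - 1]: level [n] replaces [G n] on the
   [thickness n]-neighbourhood of [Y] by [T n] where [a n] is active, and leaves the rest to
   the following, thinner levels. *)
Fixpoint glue (k n : nat) (x : X) : R :=
  match k with
  | O => G n x
  | S k' => theta n x * (a n x * T n x + (1 - a n x) * glue k' (S n) x)
            + (1 - theta n x) * G n x
  end.

Lemma smooth_aT n x : smooth (whole X) (fun u => a n u * T n u) x.
Proof.
  destruct (T_local n x) as [H|[y [Yy H]]].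
  - apply smooth_congr with (fun _ => 0); [|apply smooth_const].
    revert H. apply near_imp. intros u -> _. ring.
  - apply smooth_congr with (fun u => a n u * s n y u).
    + revert H. apply near_imp. intros u [-> _] _. reflexivity.
    + apply smooth_mul; auto using whole_subspace. exact I.
Qed.

Lemma glue_smooth k : forall n x, smooth (whole X) (glue k n) x.
Proof.
  induction k as [|k IH]; intros n x; [apply G_smooth|]. simpl.
  apply smooth_add; apply smooth_mul; auto using whole_subspace; try exact I.
  - apply smooth_add; [apply smooth_aT|]. apply smooth_mul; auto using whole_subspace; try exact I.
    apply smooth_sub; [apply smooth_const | apply a_smooth].
  - apply smooth_sub; [apply smooth_const | apply th_smooth].
Qed.

(** If level [m] ignores its tail, no earlier level sees the depth. The depth is [S k] because
    [glue 0 m] stops at [G m] before level [m] is used. *)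
Lemma glue_shift m u : (forall k, glue (S k) m u = glue 1 m u) ->
  forall j n k, (n + j)%nat = m -> glue (j + S k) n u = glue (j + 1) n u.
Proof.
  intros H j. induction j as [|j IH]; intros n k Hn.
  - replace n with m by lia. apply H.
  - simpl. rewrite (IH (S n) k) by lia. reflexivity.
Qed.

(** At a point of [Y] some [a m] is 1 nearby and kills the tail; off [Y], [theta m] vanishes nearby
    once [thickness m] is below the distance to [Y]. So the infinite gluing is locally finite and
    needs no convergence argument. *)
Lemma glue_stationary x : exists m, near x (fun u => forall k, glue (S k) m u = glue 1 m u).
Proof.
  destruct (classic (Y x)) as [Yx|NYx].
  - destruct (a_exhaust Yx) as [m Hm]. exists m. revert Hm. apply near_imp.
    intros u Hu k. simpl. rewrite Hu. ring.
  - destruct (Yclosed NYx) as [e [He Hd]].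
    destruct (@scale_small e He) as [m Hm]. exists m.
    pose proof (thickness_le m). pose proof (thickness_pos m).
    eapply near_imp; [|apply (@near_dist_ge X x Y e (thickness m)); [lra|assumption]].
    intros u Hu k. simpl. rewrite (th_0 Hu). ring.
Qed.

Definition glued (x : X) : R :=
  epsilon (inhabits 0) (fun c => exists N0, forall N, (N0 <= N)%nat -> glue N 0 x = c).

Lemma glued_eq m u : (forall k, glue (S k) m u = glue 1 m u) -> glued u = glue (m + 1) 0 u.
Proof.
  intros H. pose proof (glue_shift H (j := m) (n := 0) ) as E.
  assert (S : exists N0, forall N, (N0 <= N)%nat -> glue N 0 u = glued u).
  { unfold glued. apply epsilon_spec. exists (glue (m + 1) 0 u), (m + 1)%nat.
    intros N HN. replace N with (m + S (N - m - 1))%nat by lia. apply E. lia. }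
  destruct S as [N0 HN0]. rewrite <- (HN0 (m + S N0)%nat) by lia. apply E. lia.
Qed.

Lemma glued_near x : exists N, near x (fun u => glued u = glue N 0 u).
Proof.
  destruct (glue_stationary x) as [m Hm]. exists (m + 1)%nat.
  revert Hm. apply near_imp. intros u Hu. now apply glued_eq.
Qed.

Lemma glued_smooth x : smooth (whole X) glued x.
Proof.
  destruct (glued_near x) as [N HN]. apply smooth_congr with (glue N 0); [|apply glue_smooth].
  revert HN. apply near_imp. auto.
Qed.

Lemma tol_pos n : 0 < tol n.
Proof. pose proof (thickness_pos n). unfold tol. apply Rdiv_lt_0_compat; nra. Qed.

Lemma tol_S n : tol (S n) <= tol n.
Proof.
  pose proof (tol_pos n). unfold tol in *. rewrite thickness_S.
  replace (eps * (thickness n / 4) / (64 * C0)) with (eps * thickness n / (64 * C0) / 4)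
    by (field; lra). lra.
Qed.

Lemma theta_Y n u : Y u -> theta n u = 1.
Proof. intros Yu. apply (@th_1 n u u Yu). rewrite dist_xx. pose proof (thickness_pos n). lra. Qed.

(** On [Y] every [theta n] is 1, so the value is a convex combination of pieces that meet their
    tolerance wherever their weight is nonzero, and [tol] decreases. *)
Lemma glue_val_Y m u : Y u -> a m u = 1 -> forall j n, (n + j)%nat = m ->
  Rabs (glue (j + 1) n u - f u) <= tol n.
Proof.
  intros Yu Hm.
  assert (HT : forall n, a n u = 0 \/ Rabs (T n u - f u) <= tol n).
  { intros n. destruct (T_local n u) as [H|[y [Yy H]]]; [left; exact (near_at H)|right].
    apply near_at in H. destruct H as [-> H]. apply s_val; auto. pose proof (scale_pos n). lra. }
  intros j. induction j as [|j IH]; intros n Hn.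
  - replace n with m by lia. simpl. rewrite (theta_Y m Yu), Hm.
    destruct (HT m) as [H0|H0]; [lra|]. eapply Rle_trans; [|exact H0]. right. f_equal. ring.
  - simpl. rewrite (theta_Y n Yu). specialize (IH (S n) ltac:(lia)). pose proof (tol_S n).
    pose proof (a_01 n u) as H01.
    replace (1 * (a n u * T n u + (1 - a n u) * glue (j + 1) (S n) u) + (1 - 1) * G n u - f u)
      with (a n u * (T n u - f u) + (1 - a n u) * (glue (j + 1) (S n) u - f u)) by ring.
    eapply Rle_trans; [apply Rabs_triang|].
    rewrite !Rabs_mult, (Rabs_pos_eq (a n u)), (Rabs_pos_eq (1 - a n u)) by lra.
    destruct (HT n) as [->|H0]; [lra|]. nra.
Qed.

Lemma a_cost n : 16 * C0 / scale n * (2 * tol n) = eps / 2 * scale (S n).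
Proof.
  unfold tol, thickness. rewrite scale_S. pose proof (scale_pos n). field. lra.
Qed.

Lemma a_lip_pos n : 0 <= 16 * C0 / scale n.
Proof. apply Rlt_le, Rdiv_lt_0_compat; [lra | apply scale_pos]. Qed.

(** Induction from level [m], where the tail is cut off, back to earlier levels: the cost
    [eps / 2 * scale (S n)] of [a n] is the difference between the bounds at [n] and at [S n]. *)
Lemma glue_lip_Y m x : Y x -> near x (fun u => a m u = 1) -> forall j n, (n + j)%nat = m ->
  llip Y (fun u => glue (j + 1) n u - f u) x (eps / 2 + eps / 2 * scale n).
Proof.
  intros Yx Hm.
  assert (HT : forall n y, Y y -> near x (fun u => T n u = s n y u /\ dist u y < r y - scale n) ->
    llip Y (fun u => T n u - f u) x (eps / 2) /\
    near x (fun u => Y u -> Rabs (T n u - f u) <= tol n)).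
  { intros n y Yy H. pose proof (scale_pos n). split.
    - destruct H as [d [Hd H]]. exists d. split; [assumption|]. intros u v Yu Yv Hu Hv.
      destruct (H u Hu) as [-> Hu']. destruct (H v Hv) as [-> Hv']. apply s_lip; auto; lra.
    - revert H. apply near_imp. intros u [-> Hu] Yu. apply s_val; auto. lra. }
  intros j. induction j as [|j IH]; intros n Hn.
  - replace n with m by lia. destruct (T_local m x) as [H|[y [Yy H]]].
    + apply near_at in H. apply near_at in Hm. lra.
    + destruct (HT m y Yy H) as [HL _].
      apply llip_congr with (fun u => T m u - f u).
      * revert Hm. apply near_imp. intros u Hu Yu. simpl. rewrite (theta_Y m Yu), Hu. ring.
      * apply llip_weaken with (2 := HL). pose proof (scale_pos m). nra.
  - specialize (IH (S n) ltac:(lia)). pose proof (scale_S n) as E. pose proof (scale_pos n) as Hsc.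
    destruct (T_local n x) as [H|[y [Yy H]]].
    + apply llip_congr with (fun u => glue (j + 1) (S n) u - f u).
      * revert H. apply near_imp. intros u Hu Yu. simpl. rewrite (theta_Y n Yu), Hu. ring.
      * apply llip_weaken with (2 := IH). nra.
    + destruct (HT n y Yy H) as [HL HV]. clear H.
      apply llip_congr with (fun u => a n u * (T n u - f u)
                                      + (1 - a n u) * (glue (j + 1) (S n) u - f u)).
      * apply near_true. intros u Yu. simpl. rewrite (theta_Y n Yu). ring.
      * replace (eps / 2 + eps / 2 * scale n) with
          (eps / 2 + eps / 2 * scale (S n) + 16 * C0 / scale n * (2 * tol n))
          by (rewrite a_cost, E; field).
        apply llip_convex; [apply a_lip_pos| | | |assumption|].
        -- apply llip_of_lip. intros; apply a_lip.
        -- apply near_true. intros; apply a_01.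
        -- apply llip_weaken with (2 := HL). pose proof (scale_pos (S n)). nra.
        -- eapply near_imp; [|exact (near_and HV Hm)]. intros u [H1 H2] Yu.
           specialize (H1 Yu). pose proof (glue_val_Y Yu H2 (j := j) (n := S n) ltac:(lia)) as H3.
           pose proof (tol_S n).
           replace (T n u - f u - (glue (j + 1) (S n) u - f u)) with
             ((T n u - f u) + - (glue (j + 1) (S n) u - f u)) by ring.
           eapply Rle_trans; [apply Rabs_triang|]. rewrite Rabs_Ropp. lra.
Qed.

Lemma glued_lip_Y u v : Y u -> Y v ->
  Rabs ((glued u - f u) - (glued v - f v)) <= eps * dist u v.
Proof.
  intros Yu Yv. apply (lip_of_llip HY (f := fun u => glued u - f u)); auto. intros x Yx.
  destruct (a_exhaust Yx) as [m Hm].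
  apply llip_congr with (fun u => glue (m + 1) 0 u - f u).
  - revert Hm. apply near_imp. intros z Hz _. f_equal. apply glued_eq. intros k. simpl.
    rewrite Hz. ring.
  - replace eps with (eps / 2 + eps / 2 * scale 0) by (unfold scale; simpl; field).
    now apply glue_lip_Y with m.
Qed.

(** * The Lipschitz bound on the whole space *)

Section GluedLipschitz.
Variables (L : R) (F : X -> R).
Hypothesis HL : eps <= L.
Hypothesis F_lip : forall u v, Rabs (F u - F v) <= L * dist u v.
Hypothesis F_Y : forall y, Y y -> F y = f y.
Hypothesis s_lipX : forall n y u v, Y y -> Rabs (s n y u - s n y v) <= 2 * L * dist u v.
Hypothesis G_lip : forall n u v, Rabs (G n u - G n v) <= C0 * L * dist u v.
Hypothesis G_val : forall n u, Rabs (F u - G n u) <= tol n.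

(** [7 = 4 + 1 + 2], from comparison through a point of [Y] at distance below [2 * thickness n]: a
    local piece is [2 * L]-Lipschitz, its error on [Y] is at most [L * thickness n], and [F] is
    [L]-Lipschitz. *)
Definition gap (n : nat) : R := 7 * L * thickness n.

Lemma tol_le n : tol n <= L * thickness n.
Proof.
  pose proof (thickness_pos n). unfold tol. apply Rmult_le_reg_r with (64 * C0); [lra|].
  replace (eps * thickness n / (64 * C0) * (64 * C0)) with (eps * thickness n) by (field; lra).
  assert (eps * thickness n <= L * thickness n) by nra.
  assert (0 <= L * thickness n) by nra. nra.
Qed.

Lemma gap_S n : gap (S n) <= gap n.
Proof. unfold gap. rewrite thickness_S. pose proof (thickness_pos n). nra. Qed.

Lemma T_val n y u z : Y y -> T n u = s n y u -> dist u y < r y - scale n ->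
  Y z -> dist u z < 2 * thickness n -> Rabs (T n u - F u) <= gap n.
Proof.
  intros Yy -> Huy Yz Huz. pose proof (thickness_le n). pose proof (tol_le n).
  (* The margin [scale n >= 2 * thickness n] keeps [z] in the ball of [y], where the error bound on
     [Y] applies. *)
  assert (Hzy : dist z y < r y).
  { pose proof (dist_tri z u y) as D. rewrite (dist_sym z u) in D. lra. }
  pose proof (s_val n Yy Yz Hzy) as H1. pose proof (s_lipX n u z Yy) as H2.
  pose proof (F_lip z u) as H3. rewrite (dist_sym z u) in H3.
  replace (s n y u - F u) with ((s n y u - s n y z) + (s n y z - f z) + (F z - F u))
    by (rewrite F_Y by assumption; ring).
  eapply Rle_trans; [apply Rabs_triang|].
  eapply Rle_trans; [apply Rplus_le_compat_r, Rabs_triang|].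
  unfold gap. pose proof (dist_ge0 u z). nra.
Qed.

(** The factor 2 leaves room: a point at least [2 * thickness n] away from [Y] has a whole
    neighbourhood at least [thickness n] away. *)
Lemma near_Y_or_theta0 n x :
  (exists z, Y z /\ dist x z < 2 * thickness n) \/ near x (fun u => theta n u = 0).
Proof.
  destruct (classic (exists z, Y z /\ dist x z < 2 * thickness n)) as [H|H]; [now left|right].
  pose proof (thickness_pos n).
  eapply near_imp; [|apply (@near_dist_ge X x Y (2 * thickness n) (thickness n)); [lra|]].
  - intros u Hu. now apply th_0.
  - intros v Hv. apply Rnot_lt_le. intros Hlt. apply H. now exists v.
Qed.

Lemma convex_bound t p q e : 0 <= t <= 1 -> Rabs p <= e -> Rabs q <= e ->
  Rabs (t * p + (1 - t) * q) <= e.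
Proof.
  intros Ht Hp Hq. eapply Rle_trans; [apply Rabs_triang|].
  rewrite !Rabs_mult, (Rabs_pos_eq t), (Rabs_pos_eq (1 - t)) by lra. nra.
Qed.

Lemma G_gap n u : Rabs (G n u - F u) <= gap n.
Proof.
  rewrite Rabs_minus_sym. eapply Rle_trans; [apply G_val|]. pose proof (tol_le n).
  pose proof (thickness_pos n). unfold gap. nra.
Qed.

Lemma glue_val k : forall n u, Rabs (glue k n u - F u) <= gap n.
Proof.
  induction k as [|k IH]; intros n u; [apply G_gap|]. simpl.
  destruct (near_Y_or_theta0 n u) as [[z [Yz Hz]]|H].
  2: { apply near_at in H. rewrite H, Rmult_0_l, Rplus_0_l, Rminus_0_r, Rmult_1_l. apply G_gap. }
  pose proof (IH (S n) u) as IHu. pose proof (gap_S n).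
  match goal with |- Rabs ?t <= _ => replace t with
    (theta n u * (a n u * (T n u - F u) + (1 - a n u) * (glue k (S n) u - F u))
     + (1 - theta n u) * (G n u - F u)) by ring end.
  apply convex_bound; [apply th_01| |apply G_gap].
  destruct (T_local n u) as [Ha|[y [Yy Hy]]].
  - apply near_at in Ha. rewrite Ha, Rmult_0_l, Rplus_0_l, Rminus_0_r, Rmult_1_l. lra.
  - apply near_at in Hy. destruct Hy as [H1 H2].
    apply convex_bound; [apply a_01| now apply T_val with y z |lra].
Qed.

Lemma diff_bound p q c e : Rabs (p - c) <= e -> Rabs (q - c) <= e -> Rabs (p - q) <= 2 * e.
Proof.
  intros Hp Hq. replace (p - q) with ((p - c) + - (q - c)) by ring.
  eapply Rle_trans; [apply Rabs_triang|]. rewrite Rabs_Ropp. lra.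
Qed.

(* Switching on level [n] within [2 * thickness n] of [Y]: the cutoff [a n] varies at scale
   [scale n], whereas the functions it separates are [thickness n]-close. *)
Lemma level_lip n x k M : (exists z, Y z /\ dist x z < 2 * thickness n) -> 2 * C0 * L <= M ->
  llip (whole X) (glue k (S n)) x M ->
  llip (whole X) (fun u => a n u * T n u + (1 - a n u) * glue k (S n) u) x
    (M + 112 * C0 * L * scale n).
Proof.
  intros [z [Yz Hz]] HM IH. pose proof (scale_pos n).
  assert (HCL : 0 <= C0 * L) by nra.
  destruct (T_local n x) as [H0|[y [Yy Hy]]].
  - apply llip_congr with (glue k (S n)).
    + revert H0. apply near_imp. intros u -> _. ring.
    + apply llip_weaken with (2 := IH). nra.
  - replace (112 * C0 * L * scale n) with (16 * C0 / scale n * (2 * gap n))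
      by (unfold gap, thickness; field; lra).
    apply llip_convex; [apply a_lip_pos| | | |assumption|].
    + apply llip_of_lip. intros; apply a_lip.
    + apply near_true. intros; apply a_01.
    + apply llip_congr with (s n y).
      * revert Hy. apply near_imp. tauto.
      * apply llip_of_lip. intros u v _ _. eapply Rle_trans; [now apply s_lipX|].
        apply Rmult_le_compat_r; [apply dist_ge0|]. nra.
    + eapply near_imp; [|exact (near_and Hy (near_dist_lt Hz))].
      intros u [[H1 H2] H3] _. apply diff_bound with (F u).
      * now apply T_val with y z.
      * eapply Rle_trans; [apply glue_val | apply gap_S].
Qed.

(* The cutoffs [theta n] cost a fixed multiple of [L], but only once: where [theta n] is not
   locally constant, the following [theta]'s vanish. *)
Lemma glue_lip k : forall n x,
  llip (whole X) (glue k n) x (226 * C0 * L + 224 * C0 * L * scale n).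
Proof.
  assert (HCL : 0 <= C0 * L) by nra.
  induction k as [|k IH]; intros n x.
  { apply llip_of_lip. intros u v _ _. simpl. eapply Rle_trans; [apply G_lip|].
    apply Rmult_le_compat_r; [apply dist_ge0|]. pose proof (scale_pos n). nra. }
  pose proof (scale_S n) as E. pose proof (scale_pos n). pose proof (thickness_pos n).
  destruct (classic (exists z, Y z /\ dist x z < thickness n / 2)) as [[z [Yz Hz]]|Hfar].
  - apply llip_congr with (fun u => a n u * T n u + (1 - a n u) * glue k (S n) u).
    + eapply near_imp; [|exact (near_dist_lt Hz)]. intros u Hu _. simpl.
      rewrite (th_1 Yz Hu). ring.
    (* [theta n] is 1 nearby; the bound at [S n] plus the cost [112 * C0 * L * scale n] of [a n] is
       exactly the bound at [n]. *)
    + apply llip_weaken with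
        (226 * C0 * L + 224 * C0 * L * scale (S n) + 112 * C0 * L * scale n);
        [rewrite E; nra|].
      apply level_lip; [|rewrite E; nra|apply IH]. exists z. split; [assumption|lra].
  - destruct (near_Y_or_theta0 n x) as [Hn|Hth].
    2: { apply llip_congr with (G n).
      - revert Hth. apply near_imp. intros u Hu _. simpl. rewrite Hu. ring.
      - apply llip_of_lip. intros u v _ _. eapply Rle_trans; [apply G_lip|].
        apply Rmult_le_compat_r; [apply dist_ge0|]. nra. }
    (* In the shell where [theta n] varies, the distance to [Y] is at least [thickness n / 2], twice
       [thickness (S n)], so the next level is just [G (S n)]. Its small constant replaces the
       induction hypothesis, whence [226 = 2 + 224]. *)
    assert (Hnext : llip (whole X) (glue k (S n)) x (2 * C0 * L)).
    { apply llip_congr with (G (S n)).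
      - eapply near_imp;
          [|apply (@near_dist_ge X x Y (thickness n / 2) (thickness (S n)));
            [rewrite thickness_S; lra|]].
        + intros u Hu _. destruct k as [|k]; simpl; [reflexivity|]. rewrite (th_0 Hu). ring.
        + intros v Hv. apply Rnot_lt_le. intros Hlt. apply Hfar. now exists v.
      - apply llip_of_lip. intros u v _ _. eapply Rle_trans; [apply G_lip|].
        apply Rmult_le_compat_r; [apply dist_ge0|]. nra. }
    apply llip_weaken with
      (2 * C0 * L + 112 * C0 * L * scale n + 16 * C0 / thickness n * (2 * gap n)).
    { replace (16 * C0 / thickness n * (2 * gap n)) with (224 * C0 * L)
        by (unfold gap; field; lra). nra. }
    simpl. apply llip_convex with (f := fun u => a n u * T n u + (1 - a n u) * glue k (S n) u).
    + apply Rlt_le, Rdiv_lt_0_compat; lra.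
    + apply llip_of_lip. intros; apply th_lip.
    + apply near_true. intros; apply th_01.
    + apply level_lip; [assumption|lra|assumption].
    + apply llip_of_lip. intros u v _ _. eapply Rle_trans; [apply G_lip|].
      apply Rmult_le_compat_r; [apply dist_ge0|]. nra.
    + destruct Hn as [z [Yz Hz]]. eapply near_imp; [|exact (near_dist_lt Hz)]. intros u Hu _.
      apply diff_bound with (F u); [|apply G_gap].
      replace (a n u * T n u + (1 - a n u) * glue k (S n) u - F u)
        with (a n u * (T n u - F u) + (1 - a n u) * (glue k (S n) u - F u)) by ring.
      pose proof (glue_val k (S n) u). pose proof (gap_S n).
      destruct (T_local n u) as [Ha|[y [Yy Hy]]].
      * apply near_at in Ha. rewrite Ha, Rmult_0_l, Rplus_0_l, Rminus_0_r, Rmult_1_l. lra.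
      * apply near_at in Hy. destruct Hy as [Hy1 Hy2].
        apply convex_bound; [apply a_01| now apply T_val with y z |lra].
Qed.

Lemma glued_lip u v : Rabs (glued u - glued v) <= 450 * C0 * L * dist u v.
Proof.
  apply (lip_of_llip (whole_subspace X)); try exact I. intros x _.
  destruct (glued_near x) as [N HN].
  apply llip_congr with (glue N 0); [revert HN; apply near_imp; auto|].
  replace (450 * C0 * L) with (226 * C0 * L + 224 * C0 * L * scale 0)
    by (unfold scale; simpl; ring).
  apply glue_lip.
Qed.

End GluedLipschitz.
End Gluing.

(** * Restriction, size and differences of derivatives *)

Section Derivatives.
Variable X : Banach.
Variable S : X -> Prop.
Hypothesis HS : subspace S.

Lemma smooth_whole f x : smooth (whole X) f x -> smooth S f x.
Proof.
  intros [D [[Da [Ds [M DM]]] H]]. exists D. split.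
  - split; [intros; apply Da; exact I|]. split; [intros; apply Ds; exact I|].
    exists M. intros; apply DM; exact I.
  - intros eps Heps. destruct (H eps Heps) as [r [Hr Hl]]. exists r. split; [assumption|].
    intros. apply Hl; auto; exact I.
Qed.

(** On a short multiple of [h] the increment of [g] is controlled by [M] and differs from that of
    [D] by an arbitrarily small proportion; homogeneity removes the scaling. *)
Lemma sdiff_bound g x D M : S x -> sdiff S g x D -> llip S g x M ->
  forall h, S h -> Rabs (D h) <= M * vnorm X h.
Proof.
  intros Sx [HD Hg] [r [Hr HL]] h Sh. pose proof (vnorm_ge0 h) as Hh.
  apply le_epsilon. intros e He.
  destruct (Hg (e / (vnorm X h + 1))) as [r' [Hr' HL']]; [apply Rdiv_lt_0_compat; lra|].
  set (q := e / (vnorm X h + 1)) in *.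
  assert (Hq : q * vnorm X h <= e).
  { replace e with (q * (vnorm X h + 1)) by (unfold q; field; lra).
    assert (0 < q) by (apply Rdiv_lt_0_compat; lra). nra. }
  assert (Hmin : 0 < Rmin r r') by (now apply Rmin_glb_lt).
  pose proof (Rmin_l r r'). pose proof (Rmin_r r r').
  set (t := Rmin r r' / (vnorm X h + 1)).
  assert (Ht : 0 < t) by (apply Rdiv_lt_0_compat; lra).
  assert (Hth : t * vnorm X h < Rmin r r').
  { replace (Rmin r r') with (t * (vnorm X h + 1)) by (unfold t; field; lra). nra. }
  assert (Sth : S (vscal X t h)) by (apply HS; assumption).
  assert (Nth : vnorm X (vscal X t h) = t * vnorm X h).
  { now rewrite vnorm_scal, Rabs_pos_eq by lra. }
  assert (Sxh : S (vadd X x (vscal X t h))) by (apply HS; assumption).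
  specialize (HL _ x Sxh Sx ltac:(rewrite dist_addl; lra) ltac:(rewrite dist_xx; lra)).
  specialize (HL' _ x Sxh Sx ltac:(rewrite dist_addl; lra) ltac:(rewrite dist_xx; lra)).
  rewrite dist_addl, Nth in HL, HL'. destruct HD as [Da [Ds _]].
  rewrite Da, Ds in HL' by assumption.
  apply Rmult_le_reg_l with t; [assumption|].
  rewrite <- (Rabs_pos_eq t) at 1 by lra. rewrite <- Rabs_mult.
  set (gz := g (vadd X x (vscal X t h))) in *.
  replace (t * D h) with ((gz - g x) - (gz - (D x + t * D h) - (g x - D x))) by ring.
  unfold Rminus at 1. eapply Rle_trans; [apply Rabs_triang|]. rewrite Rabs_Ropp. nra.
Qed.

Lemma sdiff_sub f g x D E : sdiff S f x D -> sdiff S g x E ->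
  sdiff S (fun u => f u - g u) x (fun u => D u - E u).
Proof.
  intros [HD Hf] [HE Hg]. split.
  - destruct (bounded_linear_add HD (bounded_linear_scal (-1) HE)) as [Ha [Hs [M HM]]].
    split; [|split].
    + intros h k Hh Hk. specialize (Ha h k Hh Hk). lra.
    + intros c h Hh. specialize (Hs c h Hh). lra.
    + exists M. intros h Hh. replace (D h - E h) with (D h + -1 * E h) by ring. auto.
  - intros eps Heps. apply llip_congr with (fun u => (f u - D u) - (g u - E u)).
    { apply near_true. intros; ring. }
    replace eps with (eps / 2 + eps / 2) by field.
    apply llip_sub; [apply Hf | apply Hg]; lra.
Qed.

End Derivatives.

(** * Limits at a geometric rate *)

Section GeometricLimits.

(** The intervals of radius [2 * c * scale n] around [a n] are nested, because [c * scale n + 2 * c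
    * scale (S n) = 2 * c * scale n]. *)
Lemma geometric_limit (a : nat -> R) (c : R) :
  (forall n, Rabs (a (S n) - a n) <= c * scale n) ->
  exists l, forall n, Rabs (l - a n) <= 2 * c * scale n.
Proof.
  intros H.
  set (lo := fun n => a n - 2 * c * scale n). set (hi := fun n => a n + 2 * c * scale n).
  assert (Hc : 0 <= c).
  { specialize (H O). pose proof (Rabs_pos (a 1%nat - a O)). unfold scale in H. simpl in H. lra. }
  assert (Hlohi : forall n, lo n <= hi n).
  { intros n. unfold lo, hi. pose proof (scale_pos n). nra. }
  assert (Hlo : forall n, lo n <= lo (S n)).
  { intros n. unfold lo. specialize (H n). rewrite scale_S.
    pose proof (Rle_abs (a (S n) - a n)). pose proof (Rle_abs (- (a (S n) - a n))) as H'.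
    rewrite Rabs_Ropp in H'. lra. }
  assert (Hhi : forall n, hi (S n) <= hi n).
  { intros n. unfold hi. specialize (H n). rewrite scale_S.
    pose proof (Rle_abs (a (S n) - a n)). pose proof (Rle_abs (- (a (S n) - a n))) as H'.
    rewrite Rabs_Ropp in H'. lra. }
  assert (Hlo' : forall k n, lo n <= lo (k + n)%nat).
  { induction k; intros n; simpl; [lra|]. specialize (IHk n). specialize (Hlo (k + n)%nat). lra. }
  assert (Hhi' : forall k n, hi (k + n)%nat <= hi n).
  { induction k; intros n; simpl; [lra|]. specialize (IHk n). specialize (Hhi (k + n)%nat). lra. }
  assert (Hall : forall n m, lo n <= hi m).
  { intros n m. specialize (Hlo' m n). specialize (Hhi' n m).
    rewrite Nat.add_comm in Hhi'. specialize (Hlohi (m + n)%nat). lra. }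
  destruct (completeness (fun t => exists n, t = lo n)) as [l [Hub Hlub]].
  - exists (hi O). intros t [n ->]. apply Hall.
  - now exists (lo O), O.
  - exists l. intros n. apply Rabs_le.
    assert (lo n <= l) by (apply Hub; now exists n).
    assert (l <= hi n) by (apply Hlub; intros t [m ->]; apply Hall).
    unfold lo, hi in *. lra.
Qed.

Lemma geometric_zero (t c : R) : (forall n, Rabs t <= c * scale n) -> t = 0.
Proof.
  intros H. apply NNPP. intros Ht. apply Rabs_pos_lt in Ht.
  assert (Hc : 0 < c).
  { specialize (H O). unfold scale in H. simpl in H. lra. }
  destruct (@scale_small (Rabs t / c)) as [n Hn]; [now apply Rdiv_lt_0_compat|].
  specialize (H n). apply Rmult_lt_compat_l with (r := c) in Hn; [|assumption].
  replace (c * (Rabs t / c)) with (Rabs t) in Hn by (field; lra). lra.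
Qed.

Lemma geometric_unique (a : nat -> R) (l l' c c' : R) :
  (forall n, Rabs (l - a n) <= c * scale n) -> (forall n, Rabs (l' - a n) <= c' * scale n) ->
  l = l'.
Proof.
  intros H H'. apply Rminus_diag_uniq. apply geometric_zero with (c + c'). intros n.
  specialize (H n). specialize (H' n).
  replace (l - l') with ((l - a n) + - (l' - a n)) by ring.
  eapply Rle_trans; [apply Rabs_triang|]. rewrite Rabs_Ropp. lra.
Qed.

Variable X : Banach.
Variable S : X -> Prop.
Hypothesis HS : subspace S.

(** [sdiff_bound] on consecutive differences makes the derivatives at [x] converge geometrically.
    The radius of the local bound may depend on [n], since a single [n] is fixed for each [eps]. *)
Lemma smooth_limit (f : X -> R) (g : nat -> X -> R) (x : X) (c : R) : S x -> 0 <= c ->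
  (forall n, smooth S (g n) x) -> (forall n, llip S (fun u => f u - g n u) x (c * scale n)) ->
  smooth S f x.
Proof.
  intros Sx Hc Hg Hfg. destruct (fun_choice Hg) as [D HD].
  assert (Hstep : forall n h, S h ->
    Rabs (D (1 + n)%nat h - D n h) <= 2 * c * vnorm X h * scale n).
  { intros n h Sh. rewrite Rmult_assoc, (Rmult_comm (vnorm X h)), <- Rmult_assoc.
    apply (sdiff_bound HS Sx (sdiff_sub (HD (1 + n)%nat) (HD n)) (M := 2 * c * scale n));
      [|assumption].
    apply llip_congr with (fun u => (f u - g n u) - (f u - g (1 + n)%nat u)).
    { apply near_true. intros; ring. }
    apply llip_weaken with (c * scale n + c * scale (1 + n)).
    { simpl. rewrite scale_S. pose proof (scale_pos n). nra. }
    apply llip_sub; apply Hfg. }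
  assert (Hlim : forall h, exists l, S h -> forall n,
    Rabs (l - D n h) <= 4 * c * vnorm X h * scale n).
  { intros h. destruct (classic (S h)) as [Sh|Sh]; [|now exists 0].
    destruct (@geometric_limit (fun n => D n h) (2 * c * vnorm X h)) as [l Hl].
    - intros n. now apply Hstep.
    - exists l. intros _ n. specialize (Hl n). lra. }
  destruct (fun_choice Hlim) as [E HE]. pose proof HS as [S0 [Sa Ss]].
  assert (HEl : bounded_linear_on S E).
  { repeat split.
    - intros h k Hh Hk.
      apply geometric_unique with (a := fun n => D n (vadd X h k))
        (c := 4 * c * vnorm X (vadd X h k)) (c' := 4 * c * vnorm X h + 4 * c * vnorm X k).
      + now apply HE, Sa.
      + intros n. destruct (HD n) as [[Ha _] _]. rewrite Ha by assumption.
        pose proof (HE h Hh n). pose proof (HE k Hk n).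
        replace (E h + E k - (D n h + D n k)) with ((E h - D n h) + (E k - D n k)) by ring.
        eapply Rle_trans; [apply Rabs_triang|]. lra.
    - intros a h Hh.
      apply geometric_unique with (a := fun n => D n (vscal X a h))
        (c := 4 * c * vnorm X (vscal X a h)) (c' := Rabs a * (4 * c * vnorm X h)).
      + now apply HE, Ss.
      + intros n. destruct (HD n) as [[_ [Hs _]] _]. rewrite Hs by assumption.
        rewrite <- Rmult_minus_distr_l, Rabs_mult, Rmult_assoc.
        apply Rmult_le_compat_l; [apply Rabs_pos|]. now apply HE.
    - destruct (HD O) as [[_ [_ [M HM]]] _]. exists (4 * c + M). intros h Hh.
      replace (E h) with ((E h - D O h) + D O h) by ring.
      eapply Rle_trans; [apply Rabs_triang|]. specialize (HM h Hh). specialize (HE h Hh O).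
      unfold scale in HE. simpl in HE. lra. }
  exists E. split; [assumption|]. intros eps Heps.
  destruct (@scale_small (eps / (2 * (5 * c + 1)))) as [n Hn]; [apply Rdiv_lt_0_compat; lra|].
  assert (H5 : 5 * c * scale n <= eps / 2).
  { apply Rmult_lt_compat_l with (r := 5 * c + 1) in Hn; [|lra].
    replace ((5 * c + 1) * (eps / (2 * (5 * c + 1)))) with (eps / 2) in Hn by (field; lra).
    pose proof (scale_pos n). nra. }
  (* Local constants [c * scale n] for [f - g n], [eps / 2] for the remainder of [g n], and
     [4 * c * scale n] for [E - D n]. *)
  apply llip_congr with (fun u => (f u - g n u) + (g n u - D n u) - (E u - D n u)).
  { apply near_true. intros; ring. }
  apply llip_weaken with (c * scale n + eps / 2 + 4 * c * scale n); [lra|].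
  apply llip_sub; [apply llip_add; [apply Hfg | apply HD; lra]|].
  apply llip_of_lip. intros u v Su Sv.
  pose proof (bounded_linear_sub HS HEl Su Sv) as E1.
  pose proof (bounded_linear_sub HS (proj1 (HD n)) Su Sv) as E2.
  replace (E u - D n u - (E v - D n v)) with (E (vsub u v) - D n (vsub u v))
    by (rewrite E1, E2; ring).
  specialize (HE (vsub u v) (subspace_sub HS Su Sv) n). fold (dist u v) in HE. lra.
Qed.

End GeometricLimits.

(** * The extension theorem *)

Section Extend.
Variable X : Banach.
Variable C0 : R.
Hypothesis HC0 : smooth_approx X C0.
Variable Y : X -> Prop.
Hypothesis HYc : closed_subspace Y.

Lemma closed_subspace_subspace : subspace Y.
Proof. destruct HYc as [H0 [Ha [Hs _]]]. now repeat split. Qed.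

Lemma closed_subspace_far x : ~ Y x -> exists e, 0 < e /\ forall y, Y y -> e <= dist x y.
Proof.
  intros Nx. apply NNPP. intros H. apply Nx.
  assert (Hs : forall n, exists y, Y y /\ dist y x < scale n).
  { intros n. apply NNPP. intros Hn. apply H. exists (scale n).
    split; [apply scale_pos|]. intros y Yy. apply Rnot_lt_le. intros Hlt. apply Hn.
    exists y. now rewrite dist_sym. }
  destruct (fun_choice Hs) as [u Hu]. destruct HYc as [_ [_ [_ Hcl]]]. apply (Hcl u).
  - intros n. apply Hu.
  - intros e He. destruct (pow_lt_1_zero (/ 2)) with (y := e) as [N HN]; [|assumption|].
    + rewrite Rabs_pos_eq; lra.
    + exists N. intros n Hn. specialize (HN n Hn). apply Rabs_def2 in HN.
      destruct (Hu n) as [_ Hd]. unfold scale, dist in Hd. lra.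
Qed.

(* Taylor polynomial with linear part extended to [X] by Hahn-Banach, plus a smooth
   approximation of the Lipschitz-small remainder. *)
Lemma local_approximation f y D M eps : Y y -> sdiff Y f y D -> 0 <= M ->
  (forall h, Y h -> Rabs (D h) <= M * vnorm X h) -> 0 < eps ->
  exists r, 0 < r /\ forall d, 0 < d -> exists s : X -> R,
    (forall x, smooth (whole X) s x) /\
    (forall u v, Y u -> Y v -> dist u y < r -> dist v y < r ->
       Rabs ((s u - f u) - (s v - f v)) <= eps / 2 * dist u v) /\
    (forall u, Y u -> dist u y < r -> Rabs (s u - f u) <= d) /\
    (forall u v, Rabs (s u - s v) <= (M + eps) * dist u v).
Proof.
  intros Yy [HD HfD] HM HDM Heps. pose proof closed_subspace_subspace as HY.
  destruct (linear_extension HY HM HD HDM) as [l [Hl [HlM HlD]]].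
  pose proof HC0 as [HC1 Happ].
  (* The remainder is [e]-Lipschitz and its approximation [C0 * e]-Lipschitz, so their difference is
     [eps / 2]-Lipschitz. *)
  set (e := eps / (2 * (C0 + 1))).
  assert (He : 0 < e) by (apply Rdiv_lt_0_compat; lra).
  assert (Hee : (C0 + 1) * e = eps / 2) by (unfold e; field; lra).
  (* [r] is fixed before the accuracy [d]: the radii determine the levels, while [d] will depend on
     the level. *)
  destruct (HfD e He) as [r [Hr Hrem]]. exists r. split; [assumption|]. intros d Hd.
  destruct (@lip_extension X (fun u => Y u /\ dist u y < r) (fun u => f u - D u) e)
    as [g [Hg Hgf]]; [lra| | |].
  { exists y. rewrite dist_xx. auto. }
  { intros u v [Yu Hu] [Yv Hv]. now apply Hrem. }
  destruct (Happ g e ltac:(lra) Hg d Hd) as [K [HK [HKlip HKg]]].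
  assert (Hlsub : forall u v, l u - l v = l (vsub u v)).
  { intros u v. symmetry. now apply (bounded_linear_sub (whole_subspace X) Hl). }
  exists (fun u => l u + K u). split; [|split; [|split]].
  - intros x. apply smooth_add; [now apply smooth_linear | apply HK].
  - intros u v Yu Yv Hu Hv. rewrite !HlD by assumption.
    specialize (Hrem u v Yu Yv Hu Hv). specialize (HKlip u v).
    replace (D u + K u - f u - (D v + K v - f v)) with
      ((K u - K v) + - (f u - D u - (f v - D v))) by ring.
    eapply Rle_trans; [apply Rabs_triang|]. rewrite Rabs_Ropp, <- Hee. lra.
  - intros u Yu Hu. rewrite HlD by assumption. specialize (HKg u).
    rewrite Hgf in HKg by auto.
    replace (D u + K u - f u) with (- (f u - D u - K u)) by ring. rewrite Rabs_Ropp. lra.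
  - intros u v. replace (l u + K u - (l v + K v)) with ((l u - l v) + (K u - K v)) by ring.
    eapply Rle_trans; [apply Rabs_triang|]. rewrite Hlsub.
    specialize (HlM (vsub u v)). fold (dist u v) in HlM. specialize (HKlip u v).
    pose proof (dist_ge0 u v). nra.
Qed.

(** [L] and [F] enter only the last clause, so one gluing serves Lipschitz and other functions;
    without a Lipschitz bound any smooth [G] will do. *)
Lemma glued_approximation f M eps (G : nat -> X -> R) : 0 < eps ->
  (forall y, Y y -> exists D, sdiff Y f y D /\ 0 <= M y /\
     forall h, Y h -> Rabs (D h) <= M y * vnorm X h) ->
  (forall n x, smooth (whole X) (G n) x) ->
  exists K : X -> R, (forall x, smooth (whole X) K x) /\
    (forall u v, Y u -> Y v -> Rabs ((K u - f u) - (K v - f v)) <= eps * dist u v) /\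
    (forall L F, eps <= L -> (forall y, Y y -> M y <= L) ->
       (forall u v, Rabs (F u - F v) <= L * dist u v) -> (forall y, Y y -> F y = f y) ->
       (forall n u v, Rabs (G n u - G n v) <= C0 * L * dist u v) ->
       (forall n u, Rabs (F u - G n u) <= tol C0 eps n) ->
       forall u v, Rabs (K u - K v) <= 450 * C0 * L * dist u v).
Proof.
  intros Heps HD HG. pose proof HC0 as [HC1 _]. pose proof closed_subspace_subspace as HY.
  assert (Hr : forall y, exists r, Y y -> 0 < r /\ forall d, 0 < d -> exists s : X -> R,
    (forall x, smooth (whole X) s x) /\
    (forall u v, Y u -> Y v -> dist u y < r -> dist v y < r ->
       Rabs ((s u - f u) - (s v - f v)) <= eps / 2 * dist u v) /\
    (forall u, Y u -> dist u y < r -> Rabs (s u - f u) <= d) /\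
    (forall u v, Rabs (s u - s v) <= (M y + eps) * dist u v)).
  { intros y. destruct (classic (Y y)) as [Yy|Ny]; [|now exists 0].
    destruct (HD y Yy) as [D [Hd [HM HDM]]].
    destruct (local_approximation Yy Hd HM HDM Heps) as [r H]. now exists r. }
  destruct (fun_choice Hr) as [r Hr'].
  assert (Hs : forall p : nat * X, exists s : X -> R, Y (snd p) ->
    (forall x, smooth (whole X) s x) /\
    (forall u v, Y u -> Y v -> dist u (snd p) < r (snd p) -> dist v (snd p) < r (snd p) ->
       Rabs ((s u - f u) - (s v - f v)) <= eps / 2 * dist u v) /\
    (forall u, Y u -> dist u (snd p) < r (snd p) -> Rabs (s u - f u) <= tol C0 eps (fst p)) /\
    (forall u v, Rabs (s u - s v) <= (M (snd p) + eps) * dist u v)).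
  { intros [n y]. simpl. destruct (classic (Y y)) as [Yy|Ny]; [|now exists (fun _ => 0)].
    destruct (Hr' y Yy) as [_ H]. destruct (H _ (tol_pos HC1 Heps n)) as [s H'].
    now exists s. }
  destruct (fun_choice Hs) as [s0 Hs0]. set (s := fun n y => s0 (n, y)).
  assert (Hrpos : forall y, Y y -> 0 < r y) by (intros; now apply Hr').
  destruct (exists_levels s HC0 Hrpos) as [a [T [a_smooth [a_lip [a_01 [T_local a_exh]]]]]].
  destruct (fun_choice (fun n => cutoff Y HC0 (thickness_pos n))) as [th Hth].
  assert (s_val : forall n y u, Y y -> Y u -> dist u y < r y ->
    Rabs (s n y u - f u) <= tol C0 eps n).
  { intros n y u Yy. now apply (Hs0 (n, y)). }
  assert (th_1 : forall n x y, Y y -> dist x y < thickness n / 2 -> th n x = 1).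
  { intros n. apply Hth. }
  assert (th_0 : forall n x, (forall y, Y y -> thickness n <= dist x y) -> th n x = 0).
  { intros n. apply Hth. }
  exists (glued a T th G). split; [|split].
  - apply (glued_smooth closed_subspace_far (s := s) (r := r)); auto.
    + intros n y x Yy. now apply (Hs0 (n, y)).
    + intros n. apply Hth.
  - apply (glued_lip_Y G HC1 Heps HY (s := s) (r := r)); auto.
    intros n y u v Yy. now apply (Hs0 (n, y)).
  - intros L F HL HM HF HFY HGl HGv.
    apply glued_lip with (Y := Y) (f := f) (F := F) (s := s) (r := r) (eps := eps);
      auto using closed_subspace_far.
    + intros n. apply Hth.
    + intros n. apply Hth.
    + intros n y u v Yy. eapply Rle_trans; [now apply (Hs0 (n, y))|].
      apply Rmult_le_compat_r; [apply dist_ge0|]. specialize (HM y Yy). simpl. lra.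
Qed.

Lemma approximation f eps : 0 < eps -> (forall y, Y y -> smooth Y f y) ->
  exists K : X -> R, (forall x, smooth (whole X) K x) /\
    (forall u v, Y u -> Y v -> Rabs ((f u - K u) - (f v - K v)) <= eps * dist u v).
Proof.
  intros Heps Hf.
  assert (HM : forall y, exists M, Y y -> exists D, sdiff Y f y D /\ 0 <= M /\
    forall h, Y h -> Rabs (D h) <= M * vnorm X h).
  { intros y. destruct (classic (Y y)) as [Yy|Ny]; [|now exists 0].
    destruct (Hf y Yy) as [D HD]. pose proof HD as [[_ [_ [M HDM]]] _].
    exists (Rabs M). intros _. exists D. split; [assumption|]. split; [apply Rabs_pos|].
    intros h Yh. eapply Rle_trans; [now apply HDM|].
    apply Rmult_le_compat_r; [apply vnorm_ge0 | apply Rle_abs]. }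
  destruct (fun_choice HM) as [M HM'].
  destruct (glued_approximation Heps HM' (G := fun _ _ => 0)) as [K [HK [HKf _]]].
  { intros. apply smooth_const. }
  exists K. split; [assumption|]. intros u v Yu Yv.
  rewrite <- Rabs_Ropp. replace (- (f u - K u - (f v - K v))) with (K u - f u - (K v - f v)) by ring.
  auto.
Qed.

Lemma lip_approximation f eps L : 0 < eps <= L -> (forall y, Y y -> smooth Y f y) ->
  (forall u v, Y u -> Y v -> Rabs (f u - f v) <= L * dist u v) ->
  exists K : X -> R, (forall x, smooth (whole X) K x) /\
    (forall u v, Y u -> Y v -> Rabs ((f u - K u) - (f v - K v)) <= eps * dist u v) /\
    (forall u v, Rabs (K u - K v) <= 450 * C0 * L * dist u v).
Proof.
  intros [Heps HL] Hf HfL. pose proof HC0 as [HC1 Happ].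
  pose proof closed_subspace_subspace as HY.
  destruct (@lip_extension X Y f L) as [F [HF HFY]]; [lra| |assumption|].
  { exists (vzero X). apply HY. }
  destruct (fun_choice (fun n => Happ F L ltac:(lra) HF _ (tol_pos HC1 Heps n))) as [G HG].
  destruct (@glued_approximation f (fun _ => L) eps G Heps) as [K [HK [HKf HKl]]].
  { intros y Yy. destruct (Hf y Yy) as [D HD]. exists D. split; [assumption|]. split; [lra|].
    apply (sdiff_bound HY Yy HD). now apply llip_of_lip. }
  { intros n. apply HG. }
  exists K. split; [assumption|]. split.
  - intros u v Yu Yv. rewrite <- Rabs_Ropp.
    replace (- (f u - K u - (f v - K v))) with (K u - f u - (K v - f v)) by ring. auto.
  - apply HKl with F; auto.
    + intros; lra.
    + intros n. apply HG.
    + intros n u. destruct (HG n) as [_ [_ H]]. specialize (H u). lra.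
Qed.

Lemma lip_smooth_extension f L : 0 <= L -> (forall y, Y y -> smooth Y f y) ->
  (forall u v, Y u -> Y v -> Rabs (f u - f v) <= L * dist u v) ->
  exists H : X -> R, (forall x, smooth (whole X) H x) /\
    (forall u v, Rabs (H u - H v) <= 900 * C0 * L * dist u v) /\ (forall y, Y y -> H y = f y).
Proof.
  intros HL Hf HfL. pose proof HC0 as [HC1 _]. pose proof closed_subspace_subspace as HY.
  assert (Y0 : Y (vzero X)) by apply HY.
  destruct HL as [HL|<-].
  (* The iteration needs positive tolerances [L * scale n]; for [L = 0] the function is constant on
     [Y]. *)
  2: { exists (fun _ => f (vzero X)). split; [intros; apply smooth_const|]. split.
    - intros u v. rewrite Rminus_diag, Rabs_R0, Rmult_0_r, Rmult_0_l. lra.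
    - intros y Yy. specialize (HfL _ _ Y0 Yy). rewrite Rmult_0_l in HfL.
      apply Rminus_diag_uniq. pose proof (Rabs_pos (f (vzero X) - f y)).
      apply NNPP. intros H'. apply Rabs_pos_lt in H'. lra. }
  set (P := fun n (g : X -> R) => (forall x, smooth (whole X) g x) /\
    forall u v, Y u -> Y v -> Rabs ((f u - g u) - (f v - g v)) <= L * scale n * dist u v).
  assert (Hstep : forall p : nat * (X -> R), exists g', P (fst p) (snd p) ->
    P (S (fst p)) g' /\ g' (vzero X) = snd p (vzero X) /\
    forall u v, Rabs ((g' u - snd p u) - (g' v - snd p v))
                <= 450 * C0 * L * dist u v * scale (fst p)).
  { intros [n g]. simpl. destruct (classic (P n g)) as [[Hg HgL]|Hn].
    2: { exists g. tauto. }
    pose proof (scale_pos n). pose proof (scale_pos (S n)).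
    destruct (@lip_approximation (fun u => f u - g u) (L * scale (S n)) (L * scale n))
      as [K [HK [HfK HKl]]].
    - rewrite scale_S. nra.
    - intros y Yy. apply smooth_sub; [now apply Hf | apply smooth_whole, Hg].
    - assumption.
    (* Subtracting the value of [K] at the origin keeps all iterates equal there, so Lipschitz
       bounds on their differences give pointwise convergence. *)
    - exists (fun u => g u + K u - K (vzero X)). intros _. split; [split|split].
      + intros x. apply smooth_sub; [|apply smooth_const]. now apply smooth_add.
      + intros u v Yu Yv. eapply Rle_trans; [|now apply HfK]. right. f_equal. ring.
      + ring.
      + intros u v. eapply Rle_trans; [|eapply Rle_trans; [apply (HKl u v)|]].
        * right. f_equal. ring.
        * right. ring. }
  destruct (fun_choice Hstep) as [next Hnext].
  set (g := fix g n := match n with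
                       | O => fun _ => f (vzero X)
                       | S k => next (k, g k)
                       end).
  assert (HP : forall n, P n (g n)).
  { intros n. induction n as [|n IH].
    - split; [intros; apply smooth_const|]. intros u v Yu Yv.
      replace (f u - g O u - (f v - g O v)) with (f u - f v) by (simpl; ring).
      unfold scale. simpl. rewrite Rmult_1_r. now apply HfL.
    - apply (Hnext (n, g n) IH). }
  assert (Hg0 : forall n, g n (vzero X) = f (vzero X)).
  { intros n. induction n as [|n IH]; [reflexivity|].
    destruct (Hnext (n, g n) (HP n)) as [_ [E _]]. simpl in E |- *. now rewrite E. }
  assert (Hgs : forall n u v, Rabs ((g (S n) u - g n u) - (g (S n) v - g n v))
    <= 450 * C0 * L * dist u v * scale n).
  { intros n. apply (Hnext (n, g n) (HP n)). }
  assert (Hlim : forall u, exists l, forall n,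
    Rabs (l - g n u) <= 2 * (450 * C0 * L * vnorm X u) * scale n).
  { intros u. apply (@geometric_limit (fun n => g n u)). intros n.
    specialize (Hgs n u (vzero X)). rewrite !Hg0, dist_0 in Hgs.
    eapply Rle_trans; [|exact Hgs]. right. f_equal. ring. }
  destruct (fun_choice Hlim) as [H HH].
  (* The corrections from [n] on have constants [450 * C0 * L * scale k], with sum
     [900 * C0 * L * scale n]; as [g 0] is constant, [n = 0] bounds the Lipschitz constant of
     [H]. *)
  assert (HHl : forall n u v, Rabs ((H u - g n u) - (H v - g n v))
    <= 900 * C0 * L * scale n * dist u v).
  { intros n u v.
    destruct (@geometric_limit (fun n => g n u - g n v) (450 * C0 * L * dist u v)) as [l Hl].
    - intros k. eapply Rle_trans; [|apply (Hgs k u v)]. right. f_equal. ring.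
    - assert (E : H u - H v = l).
      { apply geometric_unique with (a := fun n => g n u - g n v) (2 := Hl)
          (c := 2 * (450 * C0 * L * vnorm X u) + 2 * (450 * C0 * L * vnorm X v)).
        intros k. pose proof (HH u k). pose proof (HH v k).
        replace (H u - H v - (g k u - g k v)) with ((H u - g k u) + - (H v - g k v)) by ring.
        eapply Rle_trans; [apply Rabs_triang|]. rewrite Rabs_Ropp. lra. }
      specialize (Hl n). rewrite <- E in Hl.
      replace (H u - g n u - (H v - g n v)) with (H u - H v - (g n u - g n v)) by ring.
      eapply Rle_trans; [exact Hl|]. right. ring. }
  assert (H0 : H (vzero X) = f (vzero X)).
  { apply Rminus_diag_uniq. apply geometric_zero with 0. intros n. specialize (HH (vzero X) n).
    rewrite Hg0, vnorm_zero in HH. lra. }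
  exists H. split; [|split].
  - intros x. apply (smooth_limit (whole_subspace X)) with g (900 * C0 * L).
    + exact I.
    + nra.
    + intros n. apply HP.
    + intros n. apply llip_of_lip. intros; apply HHl.
  - intros u v. specialize (HHl O u v). unfold scale in HHl. simpl in HHl.
    rewrite Rmult_1_r in HHl. eapply Rle_trans; [|exact HHl]. right. f_equal. ring.
  (* On [Y] both [H - g n] and [f - g n] vanish at the origin and have Lipschitz constants of order
     [scale n]. *)
  - intros y Yy. apply Rminus_diag_uniq.
    apply geometric_zero with (900 * C0 * L * vnorm X y + L * vnorm X y). intros n.
    specialize (HHl n y (vzero X)). destruct (HP n) as [_ HPn].
    specialize (HPn y (vzero X) Yy Y0). rewrite Hg0, H0, dist_0 in *.
    replace (H y - f y) with ((H y - g n y - (f (vzero X) - f (vzero X)))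
      + - (f y - g n y - (f (vzero X) - f (vzero X)))) by ring.
    eapply Rle_trans; [apply Rabs_triang|]. rewrite Rabs_Ropp. lra.
Qed.

Lemma smooth_extension f : (forall y, Y y -> smooth Y f y) ->
  exists H : X -> R, (forall x, smooth (whole X) H x) /\ (forall y, Y y -> H y = f y).
Proof.
  intros Hf. destruct (approximation Rlt_0_1 Hf) as [K [HK HfK]].
  destruct (@lip_smooth_extension (fun u => f u - K u) 1 Rle_0_1) as [H [HH [_ HHf]]].
  - intros y Yy. apply smooth_sub; [now apply Hf | apply smooth_whole, HK].
  - assumption.
  - exists (fun u => H u + K u). split.
    + intros x. now apply smooth_add.
    + intros y Yy. rewrite HHf by assumption. ring.
Qed.

End Extend.

Theorem theorem1p2 (X : Banach) (Hstar : property_star X) :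
  (forall (Y : X -> Prop) (f : X -> R),
     closed_subspace Y -> C1_on Y f ->
     exists H : X -> R, C1_on (whole X) H /\ (forall y, Y y -> H y = f y)) /\
  (exists C : R, 1 <= C /\
     forall (Y : X -> Prop) (f : X -> R) (L : R),
       closed_subspace Y -> C1_on Y f -> lipschitz_with Y f L ->
       exists H : X -> R, C1_on (whole X) H /\ lipschitz_with (whole X) H (C * L) /\
         (forall y, Y y -> H y = f y)).
Proof.
  destruct (smooth_approx_of_star Hstar) as [C0 HC0]. pose proof HC0 as [HC1 _]. split.
  - intros Y f HY Hf. pose proof (closed_subspace_subspace HY) as HYs.
    destruct (@smooth_extension X C0 HC0 Y HY f) as [H [HH HHf]].
    { intros y Yy. now apply smooth_of_C1. }
    exists H. split; [|assumption].
    apply C1_of_smooth; [apply whole_subspace | auto].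
  (* [C0] comes from [X] alone, so the constant is uniform in [Y] and [f]. *)
  - exists (900 * C0). split; [lra|]. intros Y f L HY Hf [HL HfL].
    pose proof (closed_subspace_subspace HY) as HYs.
    destruct (@lip_smooth_extension X C0 HC0 Y HY f L HL) as [H [HH [HHl HHf]]].
    { intros y Yy. now apply smooth_of_C1. }
    { exact HfL. }
    exists H. split; [apply C1_of_smooth; [apply whole_subspace | auto]|].
    split; [|assumption]. split; [nra|]. intros x y _ _. apply HHl.
Qed.
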